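(* Let $B\in\{0,1\}^n$ be a bit-sequence with $b$ bits set. The dynamic gap-encoded bitvector \texttt{gap\_bv} implemented in \texttt{DYNAMIC} takes at most $$2\cdot b\left(\log(n/b)+\log\log b+\mathcal{O}(\log n/\log b)\right)(1+o(1))$$ bits of space and supports \texttt{rank}, \texttt{select}, \texttt{access}, \texttt{insert}, and \texttt{delete}$_0$ operations on $B$ in $\mathcal{O}(\log b)$ time.
   Context: Logarithms are base 2. For a bitvector $B$: $\texttt{access}(i)=B[i]$; $\texttt{rank}_c(i)$ = number of occurrences of bit $c$ in $B[0..i-1]$; $\texttt{select}_c(j)$ = position of the $j$-th occurrence of bit $c$; $\texttt{insert}(i,c)$ inserts bit $c$ at position $i$; $\texttt{delete}_0(i)$ deletes a bit $0$ at position $i$. The structure \texttt{gap\_bv} encodes the bitvector $0^{s_1-1}10^{s_2-1}1\cdots0^{s_b-1}1$ (with $s_i>0$) by a searchable partial sum structure on the sequence of gap lengths $s_1,\dots,s_b$. The partial sum structure is a B-tree with constant fanout (16) storing $s_1,\dots,s_b$ in order in its leaves, each leaf holding between $0.5\log b$ and $\log b$ integers packed contiguously, each using the bit-width of the largest integer in its leaf, with space allocated only for stored integers; each node stores $\mathcal{O}(1)$ subtree-size/partial-sum counters and pointers of $\mathcal{O}(\log n)$ bits. Bitvector \texttt{access}/\texttt{rank} are reduced to partial-sum search, \texttt{select} to partial sums, \texttt{insert}$_1$ to inserting a new integer, and \texttt{insert}$_0$/\texttt{delete}$_0$ to updating a gap length. *)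

(* Defs.v *)
From HB Require Import structures.
From mathcomp Require Import all_boot all_order all_algebra.
From mathcomp Require Import all_classical all_reals all_analysis.

Set Implicit Arguments.
Unset Strict Implicit.
Unset Printing Implicit Defensive.

Definition log2 (R : realType) (x : R) : R := (ln x / ln 2)%R.

(* Positions count from 0, occurrences from 1. *)

Definition bv_access (B : seq bool) (i : nat) : bool := nth false B i.

Definition bv_rank (c : bool) (B : seq bool) (i : nat) : nat :=
  count_mem c (take i B).

Definition bv_select (c : bool) (B : seq bool) (j : nat) : nat :=
  nth 0 [seq i <- iota 0 (size B) | nth false B i == c] j.-1.

Definition bv_insert (i : nat) (c : bool) (B : seq bool) : seq bool :=
  take i B ++ c :: drop i B.

Definition bv_delete (i : nat) (B : seq bool) : seq bool :=
  take i B ++ drop i.+1 B.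

(* Cost model.

   Every algorithm returns its result with the number of elementary steps it
   has executed on a word RAM whose words hold a counter or a pointer.  An
   elementary step is a bounded number of word operations: handling one slot of
   an internal node, or one packed integer of a leaf, costs one step. *)

Definition timed (A : Type) : Type := (A * nat)%type.

Definition result (A : Type) (m : timed A) : A := m.1.
Definition time (A : Type) (m : timed A) : nat := m.2.

Definition ret (A : Type) (x : A) : timed A := (x, 0).

Definition bind (A B : Type) (m : timed A) (f : A -> timed B) : timed B :=
  (result (f (result m)), time m + time (f (result m))).

Definition spend (A : Type) (k : nat) (m : timed A) : timed A :=
  (result m, k + time m).

Notation "'let!' x := m 'in' k" := (bind m (fun x => k))
  (at level 200, x name, m at level 100, k at level 200).

(* Number and sum of the integers stored in a subtree. *)
Record counters := Counters { cnt : nat; psum : nat }.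

Definition addc (c d : counters) : counters :=
  Counters (cnt c + cnt d) (psum c + psum d).

(* A tree of height h.  A leaf is a sequence of integers; an internal node is a
   sequence of slots, each with the counters of a child and the child itself.
   Indexing by the height makes all leaves have the same depth. *)
Fixpoint btree (h : nat) : Type :=
  if h is h'.+1 then seq (counters * btree h') else seq nat.

Definition fanout : nat := 16.

Fixpoint ints (h : nat) : btree h -> seq nat :=
  match h return btree h -> seq nat with
  | 0 => id
  | h'.+1 => fun es => flatten [seq ints e.2 | e <- es]
  end.

Definition counters_of (s : seq nat) : counters := Counters (size s) (sumn s).

(* The maximum load of a leaf when b integers are stored: the integer part of
   log b (1 if b < 2). *)
Definition leaf_cap (b : nat) : nat := maxn 1 (trunc_log 2 b).

(* Leaves hold between L/2 and L integers and internal nodes have between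
   fanout/2 and fanout children; as usual, at the root the lower bounds become
   0 and 2.  With L = leaf_cap b and b >= 2, the root cannot be a leaf. *)
Fixpoint btree_wf (L : nat) (isroot : bool) (h : nat) : btree h -> bool :=
  match h return btree h -> bool with
  | 0 => fun xs =>
      (size xs <= L) && (isroot || (L <= 2 * size xs))
  | h'.+1 => fun es =>
      ((if isroot then 2 else fanout./2) <= size es <= fanout) &&
      all (fun e => [&& cnt e.1 == size (ints e.2),
                        psum e.1 == sumn (ints e.2)
                      & btree_wf L false e.2]) es
  end.

Fixpoint leaf_locate (wt : counters -> nat) (x : nat) (acc : counters)
    (xs : seq nat) : timed (counters * nat) :=
  spend 1
    (if xs is s :: xs' then
       let c := Counters 1 s in
       if x < wt c then ret (acc, s)
       else leaf_locate wt (x - wt c) (addc acc c) xs'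
     else ret (acc, 0)).

Fixpoint node_locate (T : Type)
    (rec : nat -> counters -> T -> timed (counters * nat))
    (wt : counters -> nat) (x : nat) (acc : counters)
    (es : seq (counters * T)) : timed (counters * nat) :=
  spend 1
    (if es is (c, t) :: es' then
       if x < wt c then rec x acc t
       else node_locate rec wt (x - wt c) (addc acc c) es'
     else ret (acc, 0)).

(* Finds the first integer at which the running total of the weights exceeds x;
   returns it together with the counters (added to acc) of the integers that
   precede it. *)
Fixpoint btree_locate (wt : counters -> nat) (h : nat) :
    nat -> counters -> btree h -> timed (counters * nat) :=
  match h return nat -> counters -> btree h -> timed (counters * nat) with
  | 0 => leaf_locate wt
  | h'.+1 => node_locate (@btree_locate wt h') wt
  end.

(* The weight psum gives the search operation, cnt gives access by index, and
   the following one searches among the partial sums of s_k - 1. *)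
Definition zeros (c : counters) : nat := psum c - cnt c.

(* Replaces the k-th integer s (from 0) by s + d - e.  The leaf is re-allocated,
   since the bit-width of its largest integer may change. *)
Definition leaf_update (k d e : nat) (xs : seq nat) : timed (seq nat) :=
  spend (size xs).+1 (ret (set_nth 0 xs k (nth 0 xs k + d - e))).

Fixpoint node_update (T : Type) (rec : nat -> T -> timed T) (k d e : nat)
    (es : seq (counters * T)) : timed (seq (counters * T)) :=
  spend 1
    (if es is (c, t) :: es' then
       if k < cnt c then
         let! t' := rec k t in
         ret ((Counters (cnt c) (psum c + d - e), t') :: es')
       else
         let! es'' := node_update rec (k - cnt c) d e es' in
         ret ((c, t) :: es'')
     else ret [::]).

Fixpoint btree_update (d e : nat) (h : nat) (k : nat) :
    btree h -> timed (btree h) :=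
  match h return btree h -> timed (btree h) with
  | 0 => leaf_update k d e
  | h'.+1 => node_update (@btree_update d e h') k d e
  end.

(* Insertion returns the one or two slots that replace the modified subtree. *)

Definition split_if (T : Type) (L : nat) (measure : seq T -> counters)
    (s : seq T) : timed (seq (counters * seq T)) :=
  spend (size s).+1
    (ret (if size s <= L then [:: (measure s, s)]
          else [:: (measure (take (size s)./2 s), take (size s)./2 s);
                   (measure (drop (size s)./2 s), drop (size s)./2 s)])).

Definition leaf_insert (L k x : nat) (xs : seq nat) :
    timed (seq (counters * seq nat)) :=
  spend (size xs).+1
    (split_if L counters_of (take k xs ++ x :: drop k xs)).

Fixpoint node_splice (T : Type)
    (rec : nat -> T -> timed (seq (counters * T))) (k : nat)
    (es : seq (counters * T)) : timed (seq (counters * T)) :=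
  spend 1
    (if es is (c, t) :: es' then
       if k <= cnt c then
         let! ps := rec k t in spend (size es').+1 (ret (ps ++ es'))
       else
         let! es'' := node_splice rec (k - cnt c) es' in ret ((c, t) :: es'')
     else ret [::]).

Definition slot_sum (T : Type) (es : seq (counters * T)) : counters :=
  foldr (fun e c => addc e.1 c) (Counters 0 0) es.

(* Inserts x before the k-th integer (from 0); L is the maximum leaf load. *)
Fixpoint btree_insert (L x : nat) (h : nat) (k : nat) :
    btree h -> timed (seq (counters * btree h)) :=
  match h return btree h -> timed (seq (counters * btree h)) with
  | 0 => leaf_insert L k x
  | h'.+1 => fun es =>
      let! es' := node_splice (@btree_insert L x h') k es in
      split_if fanout (@slot_sum (btree h')) es'
  end.

(* Space in bits.  Counters and pointers take w bits each.  A leaf has a header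
   of two words, and its integers all take the bit-width of the largest one; an
   internal node has fanout slots of two counters and a pointer, all of them
   allocated. *)

Definition bitwidth (x : nat) : nat := (trunc_log 2 x).+1.

Definition leaf_bits (w : nat) (xs : seq nat) : nat :=
  2 * w + size xs * bitwidth (\max_(x <- xs) x).

Fixpoint btree_bits (w : nat) (h : nat) : btree h -> nat :=
  match h return btree h -> nat with
  | 0 => leaf_bits w
  | h'.+1 => fun es => 3 * fanout * w + sumn [seq btree_bits w e.2 | e <- es]
  end.

(* The bits after the last 1 are not part of any gap; their number is kept in
   the separate counter trail. *)
Record gap_bv := GapBV {
  height : nat;
  tree : btree height;
  totals : counters;
  trail : nat
}.

Definition gap_decode (s : seq nat) : seq bool :=
  flatten [seq rcons (nseq g.-1 false) true | g <- s].

Definition gap_bits (S : gap_bv) : seq bool :=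
  gap_decode (ints (tree S)) ++ nseq (trail S) false.

Definition gap_wf (S : gap_bv) : Prop :=
  [/\ totals S = counters_of (ints (tree S)),
      all (leq 1) (ints (tree S))
    & btree_wf (leaf_cap (cnt (totals S))) true (tree S)].

Definition gap_space (w : nat) (S : gap_bv) : nat :=
  5 * w + btree_bits w (tree S).

Definition gap_locate (wt : counters -> nat) (x : nat) (S : gap_bv) :
    timed (counters * nat) :=
  btree_locate wt x (Counters 0 0) (tree S).

Definition gap_access (S : gap_bv) (i : nat) : timed bool :=
  spend 1
    (if i < psum (totals S) then
       let! p := gap_locate psum i S in ret (i.+1 == psum p.1 + p.2)
     else ret false).

Definition gap_rank1 (S : gap_bv) (i : nat) : timed nat :=
  spend 1
    (if i < psum (totals S) then
       let! p := gap_locate psum i S in ret (cnt p.1)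
     else ret (cnt (totals S))).

Definition gap_rank (c : bool) (S : gap_bv) (i : nat) : timed nat :=
  let! r := gap_rank1 S i in spend 1 (ret (if c then r else i - r)).

Definition gap_select1 (S : gap_bv) (j : nat) : timed nat :=
  let! p := gap_locate cnt j.-1 S in spend 1 (ret (psum p.1 + p.2).-1).

Definition gap_select0 (S : gap_bv) (j : nat) : timed nat :=
  spend 1
    (if j <= zeros (totals S) then
       let! p := gap_locate zeros j.-1 S in ret (j.-1 + cnt p.1)
     else ret (j.-1 + cnt (totals S))).

Definition gap_select (c : bool) (S : gap_bv) (j : nat) : timed nat :=
  if c then gap_select1 S j else gap_select0 S j.

Definition gap_update (k d e : nat) (S : gap_bv) : timed gap_bv :=
  let! t := btree_update d e k (tree S) in
  spend 1
    (ret (GapBV t (Counters (cnt (totals S)) (psum (totals S) + d - e))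
            (trail S))).

Definition set_trail (S : gap_bv) (z : nat) : gap_bv :=
  GapBV (tree S) (totals S) z.

(* Inserts the integer x before the k-th gap; the tree grows by one level when
   the root is split. *)
Definition gap_new (k x : nat) (S : gap_bv) : timed gap_bv :=
  let L := leaf_cap (cnt (totals S)).+1 in
  let! ps := btree_insert L x k (tree S) in
  spend L.+1
    (ret (if ps is [:: (c, t)] then GapBV t c (trail S)
          else @GapBV (height S).+1 ps (slot_sum ps) (trail S))).

Definition gap_insert0 (i : nat) (S : gap_bv) : timed gap_bv :=
  spend 1
    (if i < psum (totals S) then
       let! p := gap_locate psum i S in gap_update (cnt p.1) 1 0 S
     else ret (set_trail S (trail S).+1)).

(* Inside a gap s preceded by total length P, the gap is shortened to
   s - (i - P) and a new gap i - P + 1 is inserted before it. *)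
Definition gap_insert1 (i : nat) (S : gap_bv) : timed gap_bv :=
  spend 1
    (if i < psum (totals S) then
       let! p := gap_locate psum i S in
       let d := i - psum p.1 in
       let! S' := gap_update (cnt p.1) 0 d S in
       gap_new (cnt p.1) d.+1 S'
     else
       let d := i - psum (totals S) in
       gap_new (cnt (totals S)) d.+1 (set_trail S (trail S - d))).

Definition gap_insert (i : nat) (c : bool) (S : gap_bv) : timed gap_bv :=
  if c then gap_insert1 i S else gap_insert0 i S.

Definition gap_delete0 (i : nat) (S : gap_bv) : timed gap_bv :=
  spend 1
    (if i < psum (totals S) then
       let! p := gap_locate psum i S in gap_update (cnt p.1) 0 1 S
     else ret (set_trail S (trail S).-1)).

(* The structures that occur during use: those with the prescribed node and
   leaf loads, and whatever the update operations make of them.  A separate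
   notion is needed because the prescribed loads depend on b: when the integer
   part of log b increases, arbitrarily many leaves may drop below the new lower
   bound at once, and no update restructures all of them. *)
Inductive gap_state : gap_bv -> Prop :=
| gap_state_wf S : gap_wf S -> gap_state S
| gap_state_insert S i c :
    gap_state S -> i <= size (gap_bits S) ->
    gap_state (result (gap_insert i c S))
| gap_state_delete0 S i :
    gap_state S -> i < size (gap_bits S) ->
    bv_access (gap_bits S) i = false ->
    gap_state (result (gap_delete0 i S)).

(* Main.v *)
Require Import Defs.
From HB Require Import structures.
From mathcomp Require Import all_boot all_order all_algebra.
From mathcomp Require Import all_classical all_reals all_analysis.
From mathcomp Require Import zify lra ring.
Import Order.TTheory GRing.Theory Num.Theory.
Import numFieldNormedType.Exports.

Set Implicit Arguments.
Unset Strict Implicit.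
Unset Printing Implicit Defensive.

(** Searching by any additive weight (number of gaps, number of bits, number of
    zeros) locates a gap in a B-tree as it would in the plain list of gaps, so
    the queries reduce to splitting the bitvector at one gap.  A tree of height
    h >= 1 stores at least 2^h integers, so h is at most log b, and every
    operation costs O(1) per level and O(log b) in one leaf.

    For the space, let k be the number of leaves.  A leaf holding fewer than
    (log m)/2 integers was last split when at most m integers were stored, so
    there are at most m + 1 such leaves; with m about sqrt b this gives
    k = O(b / log b), which accounts for all counters and pointers.  A leaf of
    s <= log b integers with maximum M uses at most s (log M + 1) bits, and by
    concavity of the logarithm the sum of s log M over all leaves is at most
    b log (n log b / b).  Existence of a well-formed structure follows by
    inserting all gaps into an empty tree with the final leaf capacity. *)

(** * Loads and sizes of B-trees *)

Fixpoint leaves (h : nat) : btree h -> seq (seq nat) :=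
  match h return btree h -> seq (seq nat) with
  | 0 => fun xs => [:: xs]
  | h'.+1 => fun es => flatten [seq leaves e.2 | e <- es]
  end.

Fixpoint inner_nodes (h : nat) : btree h -> nat :=
  match h return btree h -> nat with
  | 0 => fun _ => 0
  | h'.+1 => fun es => (sumn [seq inner_nodes e.2 | e <- es]).+1
  end.

(** Abstracted over the payload type and its content [f], so that lemmas about one level of slots
    can be proved by list induction, apart from the recursion on the height. *)
Definition slot_counts (T : Type) (f : T -> seq nat) (e : counters * T) : bool :=
  (cnt e.1 == size (f e.2)) && (psum e.1 == sumn (f e.2)).

(* btree_wf with independent bounds lo/2 and hi on the leaf loads. *)
Fixpoint btree_ok (lo hi : nat) (isroot : bool) (h : nat) : btree h -> bool :=
  match h return btree h -> bool with
  | 0 => fun xs => (size xs <= hi) && (isroot || (lo <= 2 * size xs))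
  | h'.+1 => fun es =>
      ((if isroot then 2 else fanout./2) <= size es <= fanout) &&
      all (fun e => slot_counts (@ints h') e && btree_ok lo hi false e.2) es
  end.

Definition slot_ok (lo hi : nat) (isroot : bool) (h : nat)
    (e : counters * btree h) : bool :=
  slot_counts (@ints h) e && btree_ok lo hi isroot e.2.

Lemma btree_okS lo hi isroot h (es : seq (counters * btree h)) :
  @btree_ok lo hi isroot h.+1 es =
  ((if isroot then 2 else fanout./2) <= size es <= fanout) &&
  all (slot_ok lo hi false (h := h)) es.
Proof. by []. Qed.

Definition slots_ints (h : nat) (es : seq (counters * btree h)) : seq nat :=
  flatten [seq ints e.2 | e <- es].

Definition slots_leaves (h : nat) (es : seq (counters * btree h)) :
    seq (seq nat) :=
  flatten [seq leaves e.2 | e <- es].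

Lemma slots_ints_cons h e (es : seq (counters * btree h)) :
  slots_ints (e :: es) = ints e.2 ++ slots_ints es.
Proof. by []. Qed.

Lemma slots_leaves_cons h e (es : seq (counters * btree h)) :
  slots_leaves (e :: es) = leaves e.2 ++ slots_leaves es.
Proof. by []. Qed.

Lemma slots_ints_cat h (es1 es2 : seq (counters * btree h)) :
  slots_ints (es1 ++ es2) = slots_ints es1 ++ slots_ints es2.
Proof. by rewrite /slots_ints map_cat flatten_cat. Qed.

Lemma slots_leaves_cat h (es1 es2 : seq (counters * btree h)) :
  slots_leaves (es1 ++ es2) = slots_leaves es1 ++ slots_leaves es2.
Proof. by rewrite /slots_leaves map_cat flatten_cat. Qed.

Lemma slot_countsP (T : Type) (f : T -> seq nat) (e : counters * T) :
  reflect (e.1 = counters_of (f e.2)) (slot_counts f e).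
Proof.
case: e => -[c p] t; rewrite /slot_counts /counters_of /=.
by apply: (iffP andP) => [[/eqP-> /eqP->] | [-> ->]].
Qed.

Lemma addc_counters_of s1 s2 :
  addc (counters_of s1) (counters_of s2) = counters_of (s1 ++ s2).
Proof. by rewrite /addc /counters_of /= size_cat sumn_cat. Qed.

Lemma addcA : associative addc.
Proof. by case=> ? ? [? ?] [? ?]; rewrite /addc /= !addnA. Qed.

Lemma addc0 c : addc c (Counters 0 0) = c.
Proof. by case: c => ? ?; rewrite /addc /= !addn0. Qed.

Lemma btree_wf_ok L isroot h (t : btree h) :
  btree_wf L isroot t = btree_ok L L isroot t.
Proof.
elim: h isroot t => [//|h IHh] isroot es /=; congr (_ && _).
by apply: eq_all => e; rewrite /slot_counts IHh andbA.
Qed.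

Lemma btree_ok_mono lo lo' hi hi' isroot h (t : btree h) :
  lo' <= lo -> hi <= hi' -> btree_ok lo hi isroot t -> btree_ok lo' hi' isroot t.
Proof.
move=> le_lo le_hi; elim: h isroot t => [|h IHh] isroot es /=.
  case/andP=> szl szr; rewrite (leq_trans szl le_hi) /=.
  by case: isroot szr => //= szr; apply: leq_trans szr.
case/andP=> -> /=; apply: sub_all => e /andP[-> /=]; exact: IHh.
Qed.

Lemma slot_sumE h (es : seq (counters * btree h)) :
  all (slot_counts (@ints h)) es -> slot_sum es = counters_of (slots_ints es).
Proof.
elim: es => [//|e es IHes] /= /andP[/slot_countsP Ee /IHes ->].
by rewrite Ee addc_counters_of.
Qed.

Lemma slot_ok_counts lo hi isroot h (es : seq (counters * btree h)) :
  all (slot_ok lo hi isroot (h := h)) es -> all (slot_counts (@ints h)) es.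
Proof. by apply: sub_all => e /andP[]. Qed.

Lemma size_slots_ints_geq m h (es : seq (counters * btree h)) :
  all (fun e => m <= size (ints e.2)) es -> size es * m <= size (slots_ints es).
Proof.
elim: es => [//|e es IHes] /= /andP[me /IHes]; rewrite mulSn size_cat.
exact: leq_add.
Qed.

(** Leaves are nonempty because [0 < lo], and every non-root internal node has at least 8 children,
    so each level at least doubles the number of integers. *)
Lemma size_ints_geq lo hi h (t : btree h) :
  0 < lo -> btree_ok lo hi false t -> 2 ^ h <= size (ints t).
Proof.
move=> lo0; elim: h t => [|h IHh] t /=; first by case/andP=> _; lia.
case/andP=> /andP[sz _] ok.
have: size t * 2 ^ h <= size (slots_ints t).
  by apply: size_slots_ints_geq; apply: sub_all ok => e /andP[_] /IHh.
apply: leq_trans; rewrite expnS leq_mul2r; move: sz; rewrite /fanout; lia.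
Qed.

Lemma size_ints_root_geq lo hi h (t : btree h) :
  0 < lo -> btree_ok lo hi true t -> 0 < h -> 2 ^ h <= size (ints t).
Proof.
case: h t => [//|h] t lo0 /= /andP[/andP[sz _] ok] _.
have: size t * 2 ^ h <= size (slots_ints t).
  apply: size_slots_ints_geq; apply: sub_all ok => e /andP[_].
  exact: size_ints_geq.
by apply: leq_trans; rewrite expnS leq_mul2r sz orbT.
Qed.

Lemma slots_sum_leq h (f g : btree h -> nat) (es : seq (counters * btree h)) :
  all (fun e => f e.2 <= g e.2) es ->
  sumn [seq f e.2 | e <- es] <= sumn [seq g e.2 | e <- es].
Proof. by elim: es => [//|e es IHes] /= /andP[fg /IHes]; apply: leq_add. Qed.

Lemma size_slots_leaves h (es : seq (counters * btree h)) :
  size (slots_leaves es) = sumn [seq size (leaves e.2) | e <- es].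
Proof. by elim: es => [//|e es IHes]; rewrite /= size_cat IHes. Qed.

Lemma size_slots_ints h (es : seq (counters * btree h)) :
  size (slots_ints es) = sumn [seq size (ints e.2) | e <- es].
Proof. by elim: es => [//|e es IHes]; rewrite /= size_cat IHes. Qed.

Lemma size_leaves_leq lo hi h (t : btree h) :
  0 < lo -> btree_ok lo hi false t -> size (leaves t) <= size (ints t).
Proof.
move=> lo0; elim: h t => [|h IHh] t /=; first by case/andP=> _; lia.
case/andP=> _ ok; rewrite [X in X <= _]size_slots_leaves.
rewrite [X in _ <= X]size_slots_ints.
apply: (@slots_sum_leq h (fun t => size (leaves t)) (fun t => size (ints t))).
by apply: sub_all ok => e /andP[_] /IHh.
Qed.

(** The extra 1 accounts for the empty tree, whose root is a single empty leaf; all other leaves are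
    nonempty. *)
Lemma size_leaves_root_leq lo hi h (t : btree h) :
  0 < lo -> btree_ok lo hi true t -> size (leaves t) <= (size (ints t)).+1.
Proof.
case: h t => [//|h] t lo0 /= /andP[_ ok]; apply: leqW.
rewrite [X in X <= _]size_slots_leaves [X in _ <= X]size_slots_ints.
apply: (@slots_sum_leq h (fun t => size (leaves t)) (fun t => size (ints t))).
apply: sub_all ok => e /andP[_]; exact: size_leaves_leq.
Qed.

(** By induction each child has at least one more leaf than internal nodes. Summing over at least
    two children leaves room for the node itself. *)
Lemma inner_nodes_lt lo hi isroot h (t : btree h) :
  btree_ok lo hi isroot t -> inner_nodes t < size (leaves t).
Proof.
elim: h isroot t => [//|h IHh] isroot t /= /andP[/andP[sz _] ok].
rewrite [X in _ < X]size_slots_leaves.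
have: sumn [seq inner_nodes e.2 | e <- t] + size t
      <= sumn [seq size (leaves e.2) | e <- t].
  elim: t ok {sz} => [//|e t IHt] /= /andP[/andP[_ /IHh lt_e] /IHt]; lia.
have: 2 <= size t by move: sz; case: (isroot); rewrite /fanout; lia.
lia.
Qed.

Lemma ints_flatten h (t : btree h) : ints t = flatten (leaves t).
Proof.
elim: h t => [|h IHh] t /=; first by rewrite cats0.
elim: t => [//|e t IHt] /=; by rewrite flatten_cat IHh IHt.
Qed.

Lemma btree_bitsE w h (t : btree h) :
  btree_bits w t =
  3 * fanout * w * inner_nodes t + sumn [seq leaf_bits w l | l <- leaves t].
Proof.
elim: h t => [|h IHh] t; first by rewrite /= muln0 addn0.
rewrite [btree_bits _ _]/= [inner_nodes _]/= [leaves _]/= mulnS -addnA.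
congr (_ + _).
elim: t => [|e t IHt]; first by rewrite /= muln0.
by rewrite /= map_cat sumn_cat IHh IHt mulnDr addnACA.
Qed.

Lemma leaves_size_leq lo hi isroot h (t : btree h) :
  btree_ok lo hi isroot t -> all (fun l => size l <= hi) (leaves t).
Proof.
elim: h isroot t => [|h IHh] isroot t /=; first by case/andP=> ->.
case/andP=> _; elim: t => [//|e t IHt] /= /andP[/andP[_ /IHh oke] /IHt].
by rewrite all_cat oke.
Qed.

(** * Search and update *)

Lemma result_spend A k (m : timed A) : result (spend k m) = result m.
Proof. by []. Qed.

Lemma time_spend A k (m : timed A) : time (spend k m) = k + time m.
Proof. by []. Qed.

Lemma result_bind A B (m : timed A) (f : A -> timed B) :
  result (bind m f) = result (f (result m)).
Proof. by []. Qed.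

Lemma time_bind A B (m : timed A) (f : A -> timed B) :
  time (bind m f) = time m + time (f (result m)).
Proof. by []. Qed.

Lemma result_ret A (x : A) : result (ret x) = x.
Proof. by []. Qed.

Lemma time_ret A (x : A) : time (ret x) = 0.
Proof. by []. Qed.

Definition timedE := (result_spend, time_spend, result_bind, time_bind,
                      result_ret, time_ret).

Lemma counters_of_nil : counters_of [::] = Counters 0 0.
Proof. by []. Qed.

(** Restricted to positive integers on account of [zeros]: its subtraction is truncated, and it is
    additive only where the size does not exceed the sum. *)
Definition weight_additive (wt : counters -> nat) : Prop :=
  forall s1 s2, all (leq 1) s1 -> all (leq 1) s2 ->
  wt (counters_of (s1 ++ s2)) = wt (counters_of s1) + wt (counters_of s2).

Lemma cnt_additive : weight_additive cnt.
Proof. by move=> s1 s2 _ _; rewrite /= size_cat. Qed.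

Lemma psum_additive : weight_additive psum.
Proof. by move=> s1 s2 _ _; rewrite /= sumn_cat. Qed.

Lemma size_leq_sumn s : all (leq 1) s -> size s <= sumn s.
Proof. by elim: s => [//|x s IHs] /= /andP[x0 /IHs]; lia. Qed.

Lemma zeros_additive : weight_additive zeros.
Proof.
move=> s1 s2 /size_leq_sumn pos1 /size_leq_sumn pos2.
rewrite /zeros /= size_cat sumn_cat; lia.
Qed.

Lemma weight_additive0 wt : weight_additive wt -> wt (Counters 0 0) = 0.
Proof. by move=> /(_ [::] [::] isT isT); rewrite counters_of_nil; lia. Qed.

Lemma weight_additive1 wt x s : weight_additive wt -> all (leq 1) (x :: s) ->
  wt (counters_of (x :: s)) = wt (Counters 1 x) + wt (counters_of s).
Proof.
move=> wtD /= /andP[x0 s0].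
by rewrite -[x :: s]/([:: x] ++ s) wtD //= ?x0 // /counters_of /= addn0.
Qed.

Lemma leaf_locateP wt x acc xs :
  weight_additive wt -> all (leq 1) xs -> x < wt (counters_of xs) ->
  exists s1 g s2, [/\ xs = s1 ++ g :: s2,
    leaf_locate wt x acc xs =
      (addc acc (counters_of s1), g, (size s1).+1)
    & wt (counters_of s1) <= x < wt (counters_of s1) + wt (Counters 1 g)].
Proof.
move=> wtD; elim: xs x acc => [|g xs IHxs] x acc pos.
  by rewrite counters_of_nil weight_additive0.
rewrite weight_additive1 // => lt_x /=.
case: ltnP => [lt_xg|le_gx].
  exists [::], g, xs; rewrite counters_of_nil addc0.
  by rewrite weight_additive0.
have /= /andP[g0 pos'] := pos.
have [|s1 [g' [s2 [Exs Eloc bnd]]]] :=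
  IHxs (x - wt (Counters 1 g)) (addc acc (Counters 1 g)) pos'; first lia.
have posg1: all (leq 1) (g :: s1).
  by move: pos'; rewrite Exs all_cat /= g0 => /andP[->].
exists (g :: s1), g', s2; split; first by rewrite Exs.
  rewrite /spend /result /time Eloc /= -addcA; congr (addc _ _, _, _).
rewrite weight_additive1 //; lia.
Qed.

(** Additivity lets the comparison of [x] with the stored counters of each slot stand for a
    comparison with partial sums of the integers below. *)
Lemma node_locateP (T : Type) (f : T -> seq nat) rec wt x acc es :
  weight_additive wt -> all (slot_counts f) es ->
  all (leq 1) (flatten [seq f e.2 | e <- es]) ->
  x < wt (counters_of (flatten [seq f e.2 | e <- es])) ->
  exists es1 e es2, let s1 := flatten [seq f e.2 | e <- es1] in
  [/\ es = es1 ++ e :: es2, wt (counters_of s1) <= x,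
      x - wt (counters_of s1) < wt (counters_of (f e.2))
    & node_locate rec wt x acc es =
      spend (size es1).+1
        (rec (x - wt (counters_of s1)) (addc acc (counters_of s1)) e.2)].
Proof.
move=> wtD; elim: es x acc => [|[c t] es IHes] x acc.
  by move=> _ _; rewrite counters_of_nil weight_additive0.
move=> /= /andP[/slot_countsP /= Ec cnts]; rewrite all_cat => /andP[pos1 pos2].
rewrite wtD // -Ec => lt_x; case: ltnP => [lt_xc|le_cx].
  exists [::], (c, t), es; rewrite /= counters_of_nil.
  by rewrite addc0 weight_additive0 // subn0 -Ec; split.
have [|es1 [e [es2 [Ees le1 lt2 Eloc]]]] :=
  IHes (x - wt c) (addc acc c) cnts pos2; first lia.
have pos1': all (leq 1) (flatten [seq f e.2 | e <- es1]).
  by move: pos2; rewrite Ees map_cat flatten_cat all_cat => /andP[].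
exists ((c, t) :: es1), e, es2 => /=; rewrite wtD // -Ec subnDA.
split; [by rewrite Ees | lia | by [] |].
by rewrite Eloc -addc_counters_of -Ec addcA.
Qed.

Lemma btree_locateP lo hi isroot wt x acc h (t : btree h) :
  weight_additive wt -> btree_ok lo hi isroot t -> all (leq 1) (ints t) ->
  x < wt (counters_of (ints t)) ->
  exists s1 g s2, [/\ ints t = s1 ++ g :: s2,
    result (btree_locate wt x acc t) = (addc acc (counters_of s1), g),
    wt (counters_of s1) <= x < wt (counters_of s1) + wt (Counters 1 g)
    & time (btree_locate wt x acc t) <= fanout * h + hi].
Proof.
move=> wtD; elim: h isroot x acc t => [|h IHh] isroot x acc t.
  case/andP=> sz _ pos lt_x.
  have [s1 [g [s2 [Exs Eloc bnd]]]] := leaf_locateP acc wtD pos lt_x.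
  exists s1, g, s2; split=> //; first by rewrite /= Eloc.
  by rewrite /= Eloc /=; move: sz; rewrite [t]Exs size_cat /=; lia.
rewrite btree_okS => /andP[/andP[_ sz] oks] pos lt_x.
have cnts: all (slot_counts (@ints h)) t by apply: slot_ok_counts oks.
have [es1 [e [es2 [Et le1 lt2 Eloc]]]] :=
  @node_locateP _ (@ints h) (@btree_locate wt h) wt x acc t wtD cnts pos lt_x.
have oke: slot_ok lo hi false e.
  by move: oks; rewrite Et all_cat /= => /and3P[].
have Eints: slots_ints t = slots_ints es1 ++ ints e.2 ++ slots_ints es2.
  by rewrite Et slots_ints_cat.
have: all (leq 1) (slots_ints t) by [].
rewrite Eints !all_cat => /and3P[pos1 pose _].
have [s1 [g [s2 [Es Er bnd tm]]]] :=
  IHh _ _ (addc acc (counters_of (slots_ints es1))) _ (andP oke).2 pose lt2.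
change (@btree_locate wt h.+1 x acc t = spend (size es1).+1
  (btree_locate wt (x - wt (counters_of (slots_ints es1)))
     (addc acc (counters_of (slots_ints es1))) e.2)) in Eloc.
have pos1e: all (leq 1) s1 by move: pose; rewrite Es all_cat => /andP[].
exists (slots_ints es1 ++ s1), g, (s2 ++ slots_ints es2).
split.
- by rewrite [LHS]Eints Es -!catA.
- by rewrite Eloc timedE Er -addcA addc_counters_of.
- by rewrite wtD //; move: bnd le1; rewrite /slots_ints; lia.
- rewrite Eloc timedE mulnS -addnA leq_add //.
  by move: sz; rewrite Et size_cat /=; lia.
Qed.

Lemma leaves_all_ints (P : pred nat) h (t : btree h) :
  all P (ints t) = all (all P) (leaves t).
Proof.
rewrite ints_flatten; elim: (leaves t) => [//|l s IHs] /=.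
by rewrite all_cat IHs.
Qed.

Lemma node_updateP (T : Type) (f : T -> seq nat) rec k d e es :
  all (slot_counts f) es -> k < size (flatten [seq f a.2 | a <- es]) ->
  exists es1 a es2, let k' := k - size (flatten [seq f a.2 | a <- es1]) in
  [/\ es = es1 ++ a :: es2,
      size (flatten [seq f a.2 | a <- es1]) <= k,
      k' < size (f a.2),
      result (node_update rec k d e es) = 
        es1 ++ (Counters (cnt a.1) (psum a.1 + d - e), result (rec k' a.2)) :: es2
    & time (node_update rec k d e es) = (size es1).+1 + time (rec k' a.2)].
Proof.
elim: es k => [//|[c t] es IHes] k /= /andP[/slot_countsP /= Ec cnts].
rewrite size_cat => lt_k; case: ltnP => [lt_kc|le_ck].
  exists [::], (c, t), es; rewrite /= subn0; split=> //.
    by rewrite Ec in lt_kc.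
  by rewrite /time /= /time /= addn0.
have Ecc: cnt c = size (f t) by rewrite Ec.
have [|es1 [a [es2 [Ees le1 lt2 Er Et]]]] := IHes (k - cnt c) cnts; first lia.
exists ((c, t) :: es1), a, es2; rewrite /= size_cat subnDA -Ecc.
split=> //; [by rewrite Ees | lia | |].
  by rewrite /result /= -/(result _) Er.
by rewrite /time /= -/(time _) Et; rewrite /time /=; lia.
Qed.

(** Together with [cat_eq_catr], this aligns the splitting of a node's integers around one gap with
    their splitting by children, placing the gap inside a single child. *)
Lemma cat_eq_catl (T : Type) (a b s1 s2 : seq T) :
  a ++ b = s1 ++ s2 -> size a <= size s1 ->
  exists2 s1', s1 = a ++ s1' & b = s1' ++ s2.
Proof.
elim: a s1 => [|x a IHa] s1 /=; first by exists s1.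
case: s1 => [//|y s1] /= [<- /IHa] IH /IH[s1' -> ->]; by exists s1'.
Qed.

Lemma cat_eq_catr (T : Type) (a b s1 s2 : seq T) g :
  a ++ b = s1 ++ g :: s2 -> size s1 < size a ->
  exists2 s2', a = s1 ++ g :: s2' & s2 = s2' ++ b.
Proof.
elim: a s1 => [//|x a IHa] [|y s1] /=; first by case=> <- <-; exists a.
by case=> <- /IHa IH /IH[s2' -> ->]; exists s2'.
Qed.

(** Leaf sizes are tracked because the bound on the number of leaves depends only on them. *)
Lemma btree_updateP lo hi isroot d e s1 g s2 h (t : btree h) :
  btree_ok lo hi isroot t -> ints t = s1 ++ g :: s2 -> e <= g + d ->
  let u := btree_update d e (size s1) t in
  [/\ ints (result u) = s1 ++ (g + d - e) :: s2,
      btree_ok lo hi isroot (result u),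
      [seq size l | l <- leaves (result u)] = [seq size l | l <- leaves t]
    & time u <= fanout * h + hi.+1].
Proof.
move=> ok Et le_e; elim: h isroot s1 s2 t ok Et => [|h IHh] isroot s1 s2 t.
  case/andP=> sz szr Et u.
  have Etm: time u = (size t).+1 + 0 by [].
  have Esz: size (s1 ++ (g + d - e) :: s2) = size t.
    by rewrite [t]Et !size_cat.
  have -> : result u = (s1 ++ (g + d - e) :: s2 : btree 0).
    rewrite /u /= [t]Et nth_cat ltnn subnn /= {u Etm}.
    by elim: (s1) => [//|x s IHs] /=; rewrite IHs.
  rewrite Etm; split=> //=; rewrite ?Esz ?sz //.
  by rewrite muln0 addn0 ltnS.
rewrite btree_okS => /andP[szs oks] Es.
have cnts: all (slot_counts (@ints h)) t by apply: slot_ok_counts oks.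
have [|es1 [a [es2 [Et le1 lt2 Er Etm]]]] :=
  @node_updateP _ (@ints h) (btree_update d e (h := h)) (size s1) d e t cnts.
  by rewrite [X in _ < size X]Es size_cat /=; lia.
have Eints: slots_ints t = slots_ints es1 ++ ints a.2 ++ slots_ints es2.
  by rewrite Et slots_ints_cat.
rewrite -/(slots_ints es1) in le1 lt2 Er Etm.
have [s1' Es1 Esub] := cat_eq_catl (etrans (esym Eints) Es) le1.
rewrite Es1 size_cat addKn in lt2 Er Etm.
have [s2' Ea Es2] := cat_eq_catr Esub lt2.
have /and3P[ok1 /andP[/slot_countsP cnta oka] ok2] :
    [&& all (slot_ok lo hi false (h := h)) es1, slot_ok lo hi false a
      & all (slot_ok lo hi false (h := h)) es2].
  by move: oks; rewrite Et all_cat.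
have [Iint Iok Ilv Itm] := IHh _ _ _ _ oka Ea.
set v := btree_update d e (size s1') a.2 in Er Etm Iint Iok Ilv Itm.
set a' := (Counters _ _, _) in Er.
have Eu: result (@btree_update d e h.+1 (size s1) t) = es1 ++ a' :: es2.
  by rewrite -Er Es1 size_cat.
have Eut: time (@btree_update d e h.+1 (size s1) t) = (size es1).+1 + time v.
  by rewrite -Etm Es1 size_cat.
(* The stored sum is changed by the same truncated subtraction as the gap; [e <= g + d] makes it
   agree with the new sum. *)
have oka': slot_ok lo hi false a'.
  rewrite /slot_ok [btree_ok _ _ _ _]Iok andbT; apply/slot_countsP.
  rewrite /= Iint cnta Ea /counters_of /=; congr Counters.
    by rewrite !size_cat.
  by rewrite !sumn_cat /=; lia.
move=> u; rewrite /u Eu Eut; split.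
- rewrite [LHS](slots_ints_cat es1 (a' :: es2)) slots_ints_cons Iint Es1 Es2.
  by rewrite -!catA.
- move: szs; rewrite btree_okS Et !size_cat /= => ->.
  by rewrite all_cat ok1 /= ok2 oka'.
- rewrite Et [leaves _](slots_leaves_cat es1 (a' :: es2)).
  rewrite [X in _ = map _ X](slots_leaves_cat es1 (a :: es2)).
  by rewrite !slots_leaves_cons !map_cat Ilv.
- rewrite mulnS -addnA leq_add //.
  by move: szs; rewrite Et size_cat /=; lia.
Qed.

(** * Insertion *)

Arguments result : simpl never.
Arguments time : simpl never.

(** Counts underfull leaves relative to a load [l] that may differ from the current capacity; this
    is the quantity controlled over the history of a structure. *)
Definition light (l : nat) (s : seq (seq nat)) : nat :=
  count (fun xs => 2 * size xs < l) s.

Lemma light_cat l s1 s2 : light l (s1 ++ s2) = light l s1 + light l s2.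
Proof. exact: count_cat. Qed.

(** The cost does not depend on the position: slots up to the chosen child are walked and the
    remaining ones are copied. A position on a boundary goes to the child on its left, so appending
    at the very end is covered. *)
Lemma node_spliceP (T : Type) (f : T -> seq nat) rec k es :
  all (slot_counts f) es -> 0 < size es ->
  k <= size (flatten [seq f a.2 | a <- es]) ->
  exists es1 a es2, let k' := k - size (flatten [seq f a.2 | a <- es1]) in
  [/\ es = es1 ++ a :: es2,
      size (flatten [seq f a.2 | a <- es1]) <= k,
      k' <= size (f a.2),
      result (node_splice rec k es) = es1 ++ result (rec k' a.2) ++ es2
    & time (node_splice rec k es) = (size es).+1 + time (rec k' a.2)].
Proof.
elim: es k => [//|[c t] es IHes] k /= /andP[/slot_countsP /= Ec cnts] _.
have Ecc: cnt c = size (f t) by rewrite Ec.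
rewrite size_cat => le_k; case: leqP => [le_kc|lt_ck].
  exists [::], (c, t), es; rewrite /= subn0 -Ecc; split=> //.
  by rewrite !timedE; lia.
have [||es1 [a [es2 [Ees le1 lt2 Er Et]]]] := IHes (k - cnt c) cnts.
- by case: (es) le_k lt_ck => //=; lia.
- lia.
exists ((c, t) :: es1), a, es2; rewrite /= size_cat subnDA -Ecc.
split=> //; [by rewrite Ees | lia | by rewrite !timedE Er | ].
by rewrite !timedE Et; lia.
Qed.

Lemma all_take_drop (T : Type) (p : pred T) k s :
  all p s -> all p (take k s) && all p (drop k s).
Proof. by rewrite -{1}(cat_take_drop k s) all_cat. Qed.

Definition insert_at (k x : nat) (s : seq nat) : seq nat :=
  take k s ++ x :: drop k s.

Lemma size_insert_at k x s : size (insert_at k x s) = (size s).+1.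
Proof. by rewrite /insert_at size_cat /= addnS -size_cat cat_take_drop. Qed.

Lemma insert_at_cat k x s1 s2 s3 : size s1 <= k -> k - size s1 <= size s2 ->
  insert_at k x (s1 ++ s2 ++ s3) = s1 ++ insert_at (k - size s1) x s2 ++ s3.
Proof.
move=> le1 le2; rewrite /insert_at !take_cat !drop_cat ltnNge le1 /=.
case: ltngtP le2 => // [lt2|eq2] _; first by rewrite -!catA.
by rewrite eq2 subnn take0 drop0 take_size drop_size cats0 -!catA.
Qed.

(** Old loads are bounded by [lo] and [hi], new ones by the possibly larger [L], since the capacity
    may grow with this insertion. A split root yields two parts that meet the non-root bounds, and
    no split creates a leaf that is light for some [l <= L]. *)
Lemma btree_insertP lo hi L x isroot k h (t : btree h) :
  0 < L -> lo <= L -> hi <= L -> btree_ok lo hi isroot t ->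
  k <= size (ints t) ->
  let u := btree_insert L x k t in
  let ps := result u in
  [/\ slots_ints ps = insert_at k x (ints t),
      1 <= size ps <= 2,
      all (slot_ok lo L (isroot && (size ps == 1)) (h := h)) ps,
      forall l, l <= L -> light l (slots_leaves ps) <= light l (leaves t)
    & time u <= 40 * h + 2 * hi + 3].
Proof.
move=> L0 loL hiL; elim: h isroot k t => [|h IHh] isroot k t.
  case/andP=> sz szr le_k u.
  have Etm: time u = (size t).+1 + ((size (insert_at k x t)).+1 + 0) by [].
  have Esz: size (insert_at k x t) = (size t).+1 by rewrite size_insert_at.
  rewrite Etm [ints t]/= [leaves t]/=.
  have -> : result u = result (split_if L counters_of (insert_at k x t)) by [].
  set s := insert_at k x t in Esz *; rewrite /split_if timedE result_ret.
  case: (leqP (size s) L) => [leL|ltL].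
    rewrite /slots_ints /slots_leaves; split=> //=; rewrite ?cats0 //; [| |lia].
      rewrite /slot_ok; case: slot_countsP => //= _.
      by rewrite leL andbT /= Esz; move: szr; case: isroot => //=; lia.
    by move=> l _; rewrite /light /= Esz; lia.
  (* An overfull leaf has exactly L + 1 integers, so twice the size of either half is at least L:
     neither half is underfull or light. *)
  have EsL: size s = L.+1 by lia.
  have szt: size (take (size s)./2 s) = (size s)./2 by rewrite size_takel //; lia.
  rewrite /slots_ints /slots_leaves.
  split=> //=; rewrite ?cats0 ?cat_take_drop ?andbF //; [| |lia].
    rewrite /slot_ok; do 2!case: slot_countsP => //= _.
    by rewrite szt size_drop EsL; lia.
  by move=> l leL; rewrite /light /= szt size_drop EsL; lia.
change (btree h.+1) with (seq (counters * btree h)) in t.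
rewrite btree_okS => /andP[szs oks] le_k.
have cnts: all (slot_counts (@ints h)) t by apply: slot_ok_counts oks.
have szt: 0 < size t by move: szs; case: (isroot); rewrite /fanout; lia.
have [//|es1 [a [es2 [Et le1 le2 Er Etm]]]] :=
  @node_spliceP _ (@ints h) (btree_insert L x (h := h)) k t cnts szt.
have Eints: slots_ints t = slots_ints es1 ++ ints a.2 ++ slots_ints es2.
  by rewrite Et slots_ints_cat.
rewrite -/(slots_ints es1) in le1 le2 Er Etm.
have /and3P[ok1 /andP[/slot_countsP cnta oka] ok2] :
    [&& all (slot_ok lo hi false (h := h)) es1, slot_ok lo hi false a
      & all (slot_ok lo hi false (h := h)) es2].
  by move: oks; rewrite Et all_cat.
have [Iint Isz Iok Ilv Itm] := IHh _ _ _ oka le2.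
set v := btree_insert L x _ a.2 in Er Etm Iint Isz Iok Ilv Itm.
set ps := result v in Er Iint Isz Iok Ilv.
pose es := es1 ++ ps ++ es2.
have mono: subpred (slot_ok lo hi false (h := h)) (slot_ok lo L false (h := h)).
  by move=> e /andP[ce oke]; rewrite /slot_ok ce (btree_ok_mono _ _ oke).
have okes: all (slot_ok lo L false (h := h)) es.
  by rewrite !all_cat (sub_all mono ok1) (sub_all mono ok2) Iok.
have Ees: slots_ints es = insert_at k x (slots_ints t).
  by rewrite !slots_ints_cat Iint Eints insert_at_cat.
have Elv l : l <= L -> light l (slots_leaves es) <= light l (slots_leaves t).
  move=> leL; rewrite Et !slots_leaves_cat slots_leaves_cons !light_cat.
  by rewrite leq_add2l leq_add2r Ilv.
have szes: size t <= size es <= (size t).+1.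
  by rewrite Et !size_cat /=; lia.
move=> u.
have Eu: result u = result (split_if fanout (@slot_sum (btree h)) es).
  by rewrite /es -Er.
have Eut: time u = (size t).+1 + time v + ((size es).+1 + 0).
  by rewrite -Etm /es -Er.
rewrite Eut Eu /split_if timedE result_ret /=.
(* A level costs at most 17 steps for splicing and 18 for splitting, within the allowance of 40. *)
have tm : (size t).+1 + time v + ((size es).+1 + 0) <= 40 * h.+1 + 2 * hi + 3.
  by move: szs Itm szes; rewrite /fanout; lia.
have cntes := slot_ok_counts okes.
case: (leqP (size es) fanout) => [leF|ltF].
  split=> //=; rewrite ?cats0 ?andbT //.
    by rewrite /slots_ints /= cats0 -Ees.
  + rewrite /slot_ok btree_okS okes leF; case: slot_countsP => /=; last first.
      by rewrite slot_sumE.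
    by move=> _; move: szs; rewrite !andbT /fanout; case: (isroot) => /=; lia.
  + by move=> l leL; rewrite /slots_leaves /= cats0 Elv.
(* Overflow means exactly [fanout] + 1 slots; they split into 8 and 9, both at least half the
   fanout. *)
have EsF: size es = 17 by move: szs; rewrite /fanout in ltF *; lia.
have Ehalf: (size es)./2 = 8 by rewrite EsF.
rewrite Ehalf andbF; have /andP[ok8 ok9] := all_take_drop 8 okes.
split=> //=.
- by rewrite /slots_ints /= cats0 -[LHS]slots_ints_cat cat_take_drop.
- rewrite /slot_ok !btree_okS size_takel ?EsF // size_drop EsF ok8 ok9.
  rewrite !slot_sumE ?(slot_ok_counts ok8) ?(slot_ok_counts ok9) //.
  by do 2!case: slot_countsP.
- move=> l leL; rewrite /slots_leaves /= cats0 -[X in light l X]slots_leaves_cat.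
  by rewrite cat_take_drop Elv.
Qed.

(** * Queries on the bitvector *)

Lemma leaf_cap_gt0 b : 0 < leaf_cap b.
Proof. by rewrite leq_max. Qed.

Lemma leq_leaf_cap b b' : b <= b' -> leaf_cap b <= leaf_cap b'.
Proof. by move=> le_b; have := leq_trunc_log 2 le_b; rewrite /leaf_cap; lia. Qed.

(** This lets the cost of an insertion, which works with the new capacity, be bounded in terms of
    the old one. *)
Lemma leaf_capS b : leaf_cap b.+1 <= (leaf_cap b).+1.
Proof.
have: trunc_log 2 b.+1 <= (trunc_log 2 b).+1; last by rewrite /leaf_cap; lia.
rewrite -(leq_exp2l _ _ (isT : 1 < 2)).
have [le1 _] := andP (trunc_log_bounds (isT : 1 < 2) (isT : 0 < b.+1)).
exact: leq_trans le1 (trunc_log_ltn b (isT : 1 < 2)).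
Qed.

(** * Decoding gaps and splitting a bitvector at a position *)

Lemma gap_decode_cat s1 s2 : gap_decode (s1 ++ s2) = gap_decode s1 ++ gap_decode s2.
Proof. by rewrite /gap_decode map_cat flatten_cat. Qed.

Lemma gap_decode_cons g s :
  gap_decode (g :: s) = nseq g.-1 false ++ true :: gap_decode s.
Proof. by rewrite /gap_decode /= cat_rcons. Qed.

Lemma size_gap_decode s : all (leq 1) s -> size (gap_decode s) = sumn s.
Proof.
elim: s => [//|g s IHs] /= /andP[g0 /IHs]; rewrite gap_decode_cons.
by rewrite size_cat size_nseq /= => ->; lia.
Qed.

Lemma count_true_gap_decode s : count_mem true (gap_decode s) = size s.
Proof.
elim: s => [//|g s IHs] /=; rewrite gap_decode_cons count_cat /= IHs.
by rewrite count_nseq.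
Qed.

Lemma count_false_gap_decode s : all (leq 1) s ->
  count_mem false (gap_decode s) = sumn s - size s.
Proof.
move=> /size_gap_decode <-; rewrite -[X in _ - X]count_true_gap_decode.
rewrite -(count_predC (pred1 true)) addKn.
by apply: eq_count => -[].
Qed.

Lemma gap_decode_nseq s1 g s2 d : d < g ->
  gap_decode (s1 ++ g :: s2) =
  (gap_decode s1 ++ nseq d false) ++
  nseq (g.-1 - d) false ++ true :: gap_decode s2.
Proof.
move=> lt_d; rewrite gap_decode_cat gap_decode_cons -catA; congr (_ ++ _).
by rewrite catA -nseqD subnKC //; lia.
Qed.

Lemma bv_access_cat A x X : bv_access (A ++ x :: X) (size A) = x.
Proof. by rewrite /bv_access nth_cat ltnn subnn. Qed.

Lemma bv_rank_cat c A X : bv_rank c (A ++ X) (size A) = count_mem c A.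
Proof. by rewrite /bv_rank take_size_cat. Qed.

Lemma bv_rank_false B i : i <= size B ->
  bv_rank false B i = i - bv_rank true B i.
Proof.
move=> le_i; rewrite /bv_rank -{2}(size_takel le_i).
rewrite -(count_predC (pred1 true)) addKn; apply: eq_count => -[] //.
Qed.

Lemma bv_insert_cat c A X : bv_insert (size A) c (A ++ X) = A ++ c :: X.
Proof. by rewrite /bv_insert take_size_cat // drop_size_cat. Qed.

Lemma bv_delete_cat A x X : bv_delete (size A) (A ++ x :: X) = A ++ X.
Proof.
rewrite /bv_delete take_size_cat // -cat_rcons drop_size_cat //.
by rewrite size_rcons.
Qed.

(** The positions of [c] inside [A] fill exactly the first [count_mem c A] entries of the filtered
    list, so the next entry is [size A]. *)
Lemma bv_select_cat c A X :
  bv_select c (A ++ c :: X) (count_mem c A).+1 = size A.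
Proof.
rewrite /bv_select size_cat iotaD filter_cat /= add0n nth_cat size_filter.
have -> : count (fun i => nth false (A ++ c :: X) i == c) (iota 0 (size A))
          = count_mem c A.
  rewrite -[in RHS](mkseq_nth false A) count_map; apply: eq_in_count => i.
  by rewrite mem_iota /= nth_cat => ->.
by rewrite ltnn subnn nth_cat ltnn subnn /= eqxx.
Qed.

(** The lower load is decoupled from the count: [lo = 1] fits every reachable structure, and [lo]
    equal to the leaf capacity gives back [gap_wf]. *)
Definition gap_ok (lo : nat) (S : gap_bv) : Prop :=
  [/\ totals S = counters_of (ints (tree S)),
      all (leq 1) (ints (tree S))
    & btree_ok lo (leaf_cap (cnt (totals S))) true (tree S)].

Lemma gap_wf_ok S : gap_wf S <-> gap_ok (leaf_cap (cnt (totals S))) S.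
Proof. by rewrite /gap_wf /gap_ok btree_wf_ok. Qed.

Section GapOps.

Variables (lo : nat) (S : gap_bv).
Hypotheses (lo_gt0 : 0 < lo) (okS : gap_ok lo S).

Let M := leaf_cap (cnt (totals S)).
Let s := ints (tree S).

Lemma totals_ints : totals S = counters_of s.
Proof. by case: okS. Qed.

Lemma ints_pos : all (leq 1) s.
Proof. by case: okS. Qed.

(** A position lies either in the trail or at an offset [d] of some gap. This lemma and
    [gap_bits_gap] exhibit the prefix whose length is that position, to which the [_cat] lemmas on
    the bit operations apply. *)
Lemma gap_bits_trail d : d <= trail S ->
  gap_bits S = (gap_decode s ++ nseq d false) ++ nseq (trail S - d) false.
Proof.
move=> le_d; rewrite /gap_bits -catA; congr (_ ++ _).
by rewrite -nseqD subnKC.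
Qed.

Lemma gap_bits_gap s1 g s2 d : s = s1 ++ g :: s2 -> d < g ->
  gap_bits S = (gap_decode s1 ++ nseq d false) ++
    nseq (g.-1 - d) false ++ true :: gap_decode s2 ++ nseq (trail S) false.
Proof.
move=> Es lt_d; rewrite /gap_bits -/s Es (gap_decode_nseq _ _ lt_d).
by rewrite -!catA.
Qed.

Lemma size_gap_bits : size (gap_bits S) = psum (totals S) + trail S.
Proof.
by rewrite size_cat size_nseq size_gap_decode ?totals_ints // ints_pos.
Qed.

Lemma count_gap_bits : count_mem true (gap_bits S) = cnt (totals S).
Proof.
by rewrite count_cat count_true_gap_decode count_nseq /= totals_ints addn0.
Qed.

Lemma height_leq : height S <= M.
Proof.
case: okS => Et pos ok; case: (posnP (height S)) => [->//|h0].
have := size_ints_root_geq lo_gt0 ok h0; rewrite /M Et /=.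
by move/(trunc_log_max (isT : 1 < 2)); rewrite /leaf_cap; lia.
Qed.

Lemma gap_locateP wt x : weight_additive wt -> x < wt (totals S) ->
  exists s1 g s2, [/\ s = s1 ++ g :: s2,
    result (gap_locate wt x S) = (counters_of s1, g),
    wt (counters_of s1) <= x < wt (counters_of s1) + wt (Counters 1 g),
    size (gap_decode s1) = sumn s1
    & time (gap_locate wt x S) <= 17 * M].
Proof.
case: okS => Et pos ok wtD; rewrite Et => lt_x.
have [s1 [g [s2 [Es Er bnd tm]]]] := btree_locateP (Counters 0 0) wtD ok pos lt_x.
exists s1, g, s2; split=> //.
  by apply: size_gap_decode; move: pos; rewrite Es all_cat => /andP[].
apply: leq_trans tm _; have := height_leq; rewrite /M /fanout; lia.
Qed.

Lemma gap_accessP i : i < size (gap_bits S) ->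
  result (gap_access S i) = bv_access (gap_bits S) i /\
  time (gap_access S i) <= 100 * M.
Proof.
have M0 : 0 < M := leaf_cap_gt0 _.
rewrite size_gap_bits /gap_access => lt_i; case: ltnP => [lt_p|le_p]; last first.
  split; last by rewrite !timedE; lia.
  rewrite !timedE /bv_access /gap_bits nth_cat size_gap_decode ?ints_pos //.
  by move: le_p; rewrite totals_ints ltnNge /= => -> /=; rewrite nth_nseq if_same.
have [s1 [g [s2 [Es Er bnd sz1 tm]]]] := gap_locateP psum_additive lt_p.
rewrite !timedE Er /=; split; last lia.
pose d := i - sumn s1; have lt_d: d < g by move: bnd; rewrite /d /=; lia.
have Ei: i = size (gap_decode s1 ++ nseq d false).
  by move: bnd; rewrite size_cat size_nseq sz1 /d /=; lia.
rewrite (gap_bits_gap Es lt_d) {2}Ei.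
(* The only 1 of a gap is its last bit, at offset g - 1; smaller offsets hold zeros. *)
have [Ed|lt_d'] : d = g.-1 \/ d < g.-1 by lia.
  rewrite Ed subnn /= bv_access_cat.
  by apply/eqP; move: bnd Ed; rewrite /d /=; lia.
rewrite -(prednK (_ : 0 < g.-1 - d)) ?subn_gt0 // bv_access_cat.
by apply/negbTE/eqP; move: lt_d'; rewrite /d; lia.
Qed.

Lemma gap_rankP c i : i <= size (gap_bits S) ->
  result (gap_rank c S i) = bv_rank c (gap_bits S) i /\
  time (gap_rank c S i) <= 100 * M.
Proof.
have M0 : 0 < M := leaf_cap_gt0 _.
move=> le_i; suff [Er tm] : result (gap_rank1 S i) = bv_rank true (gap_bits S) i /\
  time (gap_rank1 S i) <= 20 * M.
  split; last first.
    by rewrite [time _](_ : _ = time (gap_rank1 S i) + (1 + 0)) //; lia.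
  rewrite [LHS](_ : _ = if c then result (gap_rank1 S i)
                        else i - result (gap_rank1 S i)) // Er.
  by case: c => //; rewrite bv_rank_false.
move: le_i; rewrite size_gap_bits /gap_rank1 => le_i.
case: ltnP => [lt_p|le_p]; last first.
  rewrite !timedE; split; last lia.
  have le_d: i - psum (totals S) <= trail S by lia.
  rewrite (gap_bits_trail le_d); set A := _ ++ nseq (i - _) _.
  have {2}-> : i = size A.
    rewrite size_cat size_nseq size_gap_decode ?ints_pos //.
    by rewrite totals_ints /= in le_p *; lia.
  rewrite bv_rank_cat count_cat count_true_gap_decode count_nseq addn0.
  by rewrite totals_ints.
have [s1 [g [s2 [Es Er bnd sz1 tm]]]] := gap_locateP psum_additive lt_p.
rewrite !timedE Er /=; split; last lia.
pose d := i - sumn s1; have lt_d: d < g by move: bnd; rewrite /d /=; lia.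
have Ei: i = size (gap_decode s1 ++ nseq d false).
  by move: bnd; rewrite size_cat size_nseq sz1 /d /=; lia.
rewrite (gap_bits_gap Es lt_d) Ei bv_rank_cat count_cat count_true_gap_decode.
by rewrite count_nseq addn0.
Qed.

Lemma gap_selectP c j : 0 < j <= count_mem c (gap_bits S) ->
  result (gap_select c S j) = bv_select c (gap_bits S) j /\
  time (gap_select c S j) <= 100 * M.
Proof.
have M0 : 0 < M := leaf_cap_gt0 _.
case: c => /andP[j0]; rewrite /gap_select.
  rewrite count_gap_bits => le_j; have lt_j: j.-1 < cnt (totals S) by lia.
  have [s1 [g [s2 [Es Er bnd sz1 tm]]]] := gap_locateP cnt_additive lt_j.
  rewrite /gap_select1 !timedE Er /=; split; last lia.
  have g0: 0 < g by move: ints_pos; rewrite Es all_cat /= => /and3P[].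
  (* The split is at offset g - 1, just before the 1 that ends the located gap; j - 1 ones precede
     it. *)
  rewrite (gap_bits_gap Es (_ : g.-1 < g)) ?prednK // subnn.
  set A := gap_decode s1 ++ _.
  have -> : j = (count_mem true A).+1.
    rewrite count_cat count_true_gap_decode count_nseq addn0.
    by move: bnd => /=; lia.
  rewrite bv_select_cat size_cat size_nseq sz1; lia.
have zE : zeros (totals S) = sumn s - size s by rewrite totals_ints.
rewrite count_cat count_nseq mul1n count_false_gap_decode ?ints_pos //.
rewrite -/s -zE => le_j.
rewrite /gap_select0; case: (leqP j (zeros (totals S))) => [le_z|lt_z]; last first.
  rewrite !timedE; split; last lia.
  have le_d: j.-1 - zeros (totals S) < trail S by lia.
  rewrite (gap_bits_trail (ltnW le_d)); set A := _ ++ nseq (j.-1 - _) _.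
  rewrite -(prednK (_ : 0 < trail S - _)) ?subn_gt0 //.
  have Ej : j = (count_mem false A).+1.
    rewrite count_cat count_nseq mul1n count_false_gap_decode ?ints_pos //.
    by rewrite -/s -zE; lia.
  rewrite [X in bv_select _ _ X]Ej bv_select_cat size_cat size_nseq.
  rewrite size_gap_decode ?ints_pos //.
  have Ec : cnt (totals S) = size s by rewrite totals_ints.
  by have := size_leq_sumn ints_pos; rewrite Ec zE in lt_z *; lia.
have lt_j: j.-1 < zeros (totals S) by lia.
have [s1 [g [s2 [Es Er bnd sz1 tm]]]] := gap_locateP zeros_additive lt_j.
rewrite !timedE Er /=; split; last lia.
have pos1 : all (leq 1) s1 by move: ints_pos; rewrite Es all_cat => /andP[].
have le1 := size_leq_sumn pos1.
(* The offset of the sought 0 in its gap. The gap contributes g - 1 zeros to the weight, so this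
   offset stays before the final 1. *)
pose d := j.-1 - zeros (counters_of s1).
have lt_d: d < g.-1 by move: bnd; rewrite /d /zeros /=; lia.
rewrite (gap_bits_gap Es (_ : d < g)); last lia.
rewrite -(prednK (_ : 0 < g.-1 - d)) ?subn_gt0 //.
set A := gap_decode s1 ++ _.
have Ej : j = (count_mem false A).+1.
  rewrite count_cat count_nseq mul1n count_false_gap_decode //.
  by move: bnd; rewrite /d /zeros /=; lia.
rewrite [X in bv_select _ _ X]Ej bv_select_cat size_cat size_nseq sz1.
by move: bnd; rewrite /d /zeros /=; lia.
Qed.

End GapOps.

(** * Updates of the bitvector *)

Lemma cons_nseq (T : Type) n (x : T) : x :: nseq n x = nseq n.+1 x.
Proof. by []. Qed.

(** The strict inequality [e < g + d] keeps the changed gap positive. *)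
Lemma gap_updateP lo S s1 g s2 d e :
  0 < lo -> gap_ok lo S -> ints (tree S) = s1 ++ g :: s2 -> e < g + d ->
  let u := gap_update (size s1) d e S in
  [/\ ints (tree (result u)) = s1 ++ (g + d - e) :: s2,
      gap_ok lo (result u) /\ trail (result u) = trail S,
      cnt (totals (result u)) = cnt (totals S),
      forall l, light l (leaves (tree (result u))) = light l (leaves (tree S))
    & time u <= 19 * leaf_cap (cnt (totals S))].
Proof.
move=> lo0 okS Es lt_e; have ht := height_leq lo0 okS.
have M0 := leaf_cap_gt0 (cnt (totals S)).
case: okS => Et pos ok.
have [Ei ok' Elv tm] := btree_updateP ok Es (ltnW lt_e).
rewrite /gap_update !timedE /=; split=> //.
- split=> //; split=> //=; rewrite Ei.
  + rewrite Et Es /counters_of /= !size_cat !sumn_cat /=; congr Counters.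
    by lia.
  + by move: pos; rewrite Es !all_cat /= => /and3P[-> _ ->]; rewrite andbT subn_gt0.
- move=> l; rewrite /light.
  have E (t : seq (seq nat)) : count (fun xs => 2 * size xs < l) t
      = count (fun k => 2 * k < l) [seq size xs | xs <- t] by rewrite count_map.
  by rewrite !E Elv.
- by move: tm; rewrite /fanout; lia.
Qed.

Lemma gap_newP lo S k x :
  0 < lo -> lo <= leaf_cap (cnt (totals S)) -> gap_ok lo S ->
  k <= cnt (totals S) -> 0 < x ->
  let u := gap_new k x S in
  [/\ ints (tree (result u)) = insert_at k x (ints (tree S)),
      gap_ok lo (result u) /\ trail (result u) = trail S,
      cnt (totals (result u)) = (cnt (totals S)).+1,
      forall l, l <= leaf_cap (cnt (totals S)).+1 ->
        light l (leaves (tree (result u))) <= light l (leaves (tree S))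
    & time u <= 50 * leaf_cap (cnt (totals S))].
Proof.
move=> lo0 loM okS le_k x0; have ht := height_leq lo0 okS.
have M0 := leaf_cap_gt0 (cnt (totals S)).
have MS := leaf_capS (cnt (totals S)).
have leM := leq_leaf_cap (leqnSn (cnt (totals S))).
case: okS => Et pos ok.
have le_k' : k <= size (ints (tree S)) by rewrite Et in le_k.
have [Ei sz oks Elv tm] :=
  btree_insertP x (leaf_cap_gt0 _) (leq_trans loM leM) leM ok le_k'.
have Ecnt : (cnt (totals S)).+1 = size (insert_at k x (ints (tree S))).
  by rewrite size_insert_at Et.
have pos' : all (leq 1) (insert_at k x (ints (tree S))).
  by rewrite all_cat /= x0; case/andP: (all_take_drop k pos) => -> ->.
have tm' : time (gap_new k x S) <= 50 * leaf_cap (cnt (totals S)).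
  by rewrite /gap_new !timedE; lia.
move=> u; rewrite {}/u; set S' := result _.
suff [Ei' okS' Etr Elv'] : [/\ ints (tree S') = insert_at k x (ints (tree S)),
    [/\ totals S' = counters_of (ints (tree S')) &
        btree_ok lo (leaf_cap (cnt (totals S)).+1) true (tree S')],
    trail S' = trail S
    & forall l, l <= leaf_cap (cnt (totals S)).+1 ->
        light l (leaves (tree S')) <= light l (leaves (tree S))].
  have [Et' ok'] := okS'.
  have Ec' : cnt (totals S') = (cnt (totals S)).+1 by rewrite Et' Ei' Ecnt.
  by split=> //; split=> //; split=> //; rewrite ?Ei' ?Ec'.
rewrite {tm'}/S' /gap_new result_bind result_spend result_ret.
set ps := result _ in Ei sz oks Elv *.
(* One slot means that the root was not split. Two slots become a new root one level higher, whose
   children satisfy the non-root bounds. *)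
case: ps Ei sz oks Elv => [//|[c t] [|a [|//]]] Ei _ oks Elv.
  move: oks Elv; rewrite /= andbT /slots_leaves /= cats0.
  move=> /andP[/slot_countsP /= Ec okt] Elv.
  by move: Ei; rewrite /slots_ints /= cats0 => Ei; split.
split=> //; split.
  by rewrite [LHS]slot_sumE // (slot_ok_counts oks).
by rewrite [tree _]/= btree_okS; rewrite andbF in oks; rewrite oks.
Qed.

Lemma gap_insertP lo S i c :
  0 < lo -> lo <= leaf_cap (cnt (totals S)) -> gap_ok lo S ->
  i <= size (gap_bits S) ->
  let u := gap_insert i c S in
  [/\ gap_bits (result u) = bv_insert i c (gap_bits S),
      gap_ok lo (result u),
      cnt (totals (result u)) = cnt (totals S) + c,
      forall l, l <= leaf_cap (cnt (totals S) + c) ->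
        light l (leaves (tree (result u))) <= light l (leaves (tree S))
    & time u <= 100 * leaf_cap (cnt (totals S))].
Proof.
move=> lo0 loM okS; rewrite (size_gap_bits okS) => le_i.
have M0 := leaf_cap_gt0 (cnt (totals S)).
have [Et pos ok] := okS.
have [lt_p|le_p] := ltnP i (psum (totals S)); last first.
  pose d := i - psum (totals S); have le_d : d <= trail S by rewrite /d; lia.
  have Ei : i = size (gap_decode (ints (tree S)) ++ nseq d false).
    move: le_p; rewrite /d size_cat size_nseq size_gap_decode // Et /=; lia.
  have EB := gap_bits_trail le_d; set A := _ ++ nseq d _ in Ei EB.
  case: c => u; rewrite {}/u /gap_insert.
    (* The first d trailing zeros and the new 1 form a gap of length d + 1 after all existing gaps;
       the other zeros remain in the trail. *)
    pose T := set_trail S (trail S - d).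
    have okT : gap_ok lo T by [].
    have [Ei' [ok' Etr] Ec Elv tm] :=
      gap_newP lo0 (loM : _ <= leaf_cap (cnt (totals T))) okT (leqnn _) (ltn0Sn d).
    have Er : result (gap_insert1 i S) = result (gap_new (cnt (totals T)) d.+1 T).
      by rewrite /gap_insert1 ltnNge le_p.
    have Etm : time (gap_insert1 i S) = 1 + time (gap_new (cnt (totals T)) d.+1 T).
      by rewrite /gap_insert1 ltnNge le_p.
    rewrite Er Etm; split=> //; [|by rewrite Ec addn1|by rewrite addn1|].
      rewrite {1}/gap_bits Ei' Etr EB [X in bv_insert X]Ei bv_insert_cat.
      rewrite /A /insert_at.
      rewrite /T /= Et /= take_size drop_size gap_decode_cat gap_decode_cons.
      by rewrite -!catA.
    by move: tm; rewrite /T /=; lia.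
  have Er : gap_insert0 i S = spend 1 (ret (set_trail S (trail S).+1)).
    by rewrite /gap_insert0 ltnNge le_p.
  rewrite Er !timedE addn0; split=> //; [|by rewrite addn0|lia].
  rewrite EB [X in bv_insert X]Ei bv_insert_cat /gap_bits /= /A -!catA.
  congr (_ ++ _).
  rewrite !cons_nseq -nseqD; congr (nseq _ _); lia.
have [s1 [g [s2 [Es Er bnd sz1 tm]]]] := gap_locateP lo0 okS psum_additive lt_p.
pose d := i - sumn s1; have lt_d : d < g by move: bnd; rewrite /d /=; lia.
have Ei : i = size (gap_decode s1 ++ nseq d false).
  by move: bnd; rewrite size_cat size_nseq sz1 /d /=; lia.
have EB := gap_bits_gap Es lt_d; set A := _ ++ nseq d _ in Ei EB.
case: c => u; rewrite {}/u /gap_insert.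
  (* Removing the d zeros before the new 1 leaves a gap of length g - d, positive since d < g. *)
  have [|Ei1 [ok1 Etr1] Ec1 Elv1 tm1] := gap_updateP (d := 0) (e := d) lo0 okS Es.
    by lia.
  set T := gap_update _ _ _ _ in Ei1 ok1 Etr1 Ec1 Elv1 tm1.
  have le_k : size s1 <= cnt (totals (result T)).
    by rewrite Ec1 Et Es /= size_cat; lia.
  rewrite -Ec1 in loM.
  have [Ei' [ok' Etr] Ec Elv tm'] := gap_newP lo0 loM ok1 le_k (ltn0Sn d).
  rewrite Ec1 in Ec Elv tm'.
  have Er' : result (gap_insert1 i S) = result (gap_new (size s1) d.+1 (result T)).
    by rewrite /gap_insert1 lt_p result_spend result_bind Er.
  have Etm : time (gap_insert1 i S) = 1 + (time (gap_locate psum i S) +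
      (time T + time (gap_new (size s1) d.+1 (result T)))).
    by rewrite /gap_insert1 lt_p time_spend time_bind Er.
  rewrite Er' Etm; split=> //; [|by rewrite Ec addn1| |].
  - rewrite {1}/gap_bits Ei' Etr Etr1 EB [X in bv_insert X]Ei bv_insert_cat.
    rewrite /A Ei1 /insert_at.
    rewrite take_size_cat // drop_size_cat // addn0 gap_decode_cat !gap_decode_cons.
    have -> : (g - d).-1 = g.-1 - d by lia.
    by rewrite -!catA /= -!catA.
  - by move=> l; rewrite addn1 => lel; rewrite -Elv1 Elv.
  - lia.
have [|Ei1 [ok1 Etr1] Ec1 Elv1 tm1] := gap_updateP (d := 1) (e := 0) lo0 okS Es.
  by lia.
set T := gap_update _ _ _ _ in Ei1 ok1 Etr1 Ec1 Elv1 tm1.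
have Er' : result (gap_insert0 i S) = result T.
  by rewrite /gap_insert0 lt_p result_spend result_bind Er.
have Etm : time (gap_insert0 i S) = 1 + (time (gap_locate psum i S) + time T).
  by rewrite /gap_insert0 lt_p time_spend time_bind Er.
rewrite Er' Etm; split=> //; [|by rewrite Ec1 addn0|by move=> l _; rewrite Elv1|lia].
rewrite {1}/gap_bits Ei1 Etr1 EB [X in bv_insert X]Ei bv_insert_cat /A.
rewrite (gap_decode_nseq _ _ (_ : d < g + 1 - 0)); last lia.
have -> : (g + 1 - 0).-1 - d = (g.-1 - d).+1 by lia.
by rewrite -!catA.
Qed.

Lemma gap_delete0P lo S i :
  0 < lo -> gap_ok lo S ->
  i < size (gap_bits S) -> bv_access (gap_bits S) i = false ->
  let u := gap_delete0 i S in
  [/\ gap_bits (result u) = bv_delete i (gap_bits S),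
      gap_ok lo (result u),
      cnt (totals (result u)) = cnt (totals S),
      forall l, light l (leaves (tree (result u))) = light l (leaves (tree S))
    & time u <= 100 * leaf_cap (cnt (totals S))].
Proof.
move=> lo0 okS; rewrite (size_gap_bits okS) => lt_i acc.
have M0 := leaf_cap_gt0 (cnt (totals S)).
have [Et pos ok] := okS.
have [lt_p|le_p] := ltnP i (psum (totals S)); last first.
  pose d := i - psum (totals S); have lt_d : d < trail S by rewrite /d; lia.
  have Ei : i = size (gap_decode (ints (tree S)) ++ nseq d false).
    move: le_p; rewrite /d size_cat size_nseq size_gap_decode // Et /=; lia.
  have EB := gap_bits_trail (ltnW lt_d); set A := _ ++ nseq d _ in Ei EB.
  have Er : gap_delete0 i S = spend 1 (ret (set_trail S (trail S).-1)).
    by rewrite /gap_delete0 ltnNge le_p.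
  move=> u; rewrite {}/u Er !timedE; split=> //; last lia.
  rewrite EB [X in bv_delete X]Ei -(prednK (_ : 0 < trail S - d)) ?subn_gt0 //.
  rewrite bv_delete_cat /gap_bits /= /A -!catA; congr (_ ++ _).
  rewrite -nseqD; congr (nseq _ _); lia.
have [s1 [g [s2 [Es Er bnd sz1 tm]]]] := gap_locateP lo0 okS psum_additive lt_p.
pose d := i - sumn s1; have lt_d : d < g by move: bnd; rewrite /d /=; lia.
have Ei : i = size (gap_decode s1 ++ nseq d false).
  by move: bnd; rewrite size_cat size_nseq sz1 /d /=; lia.
have EB := gap_bits_gap Es lt_d; set A := _ ++ nseq d _ in Ei EB.
(* The deleted bit is 0, hence not the final 1 of its gap; so g is at least 2 and the shortened gap
   stays positive. *)
have lt_d' : d < g.-1.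
  rewrite ltn_neqAle -ltnS (ltn_predK lt_d) lt_d andbT; apply: contraFneq acc => Ed.
  by rewrite EB Ei -Ed subnn /= bv_access_cat.
have [|Ei1 [ok1 Etr1] Ec1 Elv1 tm1] := gap_updateP (d := 0) (e := 1) lo0 okS Es.
  by lia.
set T := gap_update _ _ _ _ in Ei1 ok1 Etr1 Ec1 Elv1 tm1.
have Er' : result (gap_delete0 i S) = result T.
  by rewrite /gap_delete0 lt_p result_spend result_bind Er.
have Etm : time (gap_delete0 i S) = 1 + (time (gap_locate psum i S) + time T).
  by rewrite /gap_delete0 lt_p time_spend time_bind Er.
move=> u; rewrite {}/u Er' Etm; split=> //; last lia.
rewrite {1}/gap_bits Ei1 Etr1 EB [X in bv_delete X]Ei.
rewrite -(prednK (_ : 0 < g.-1 - d)) ?subn_gt0 //.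
rewrite bv_delete_cat /A (gap_decode_nseq _ _ (_ : d < g + 0 - 1)); last lia.
have -> : (g + 0 - 1).-1 - d = (g.-1 - d).-1 by lia.
by rewrite -!catA.
Qed.

(** * Existence and number of leaves *)

Lemma btree_exists L s : 0 < L ->
  exists h (t : btree h), ints t = s /\ btree_ok L L true t.
Proof.
move=> L0; elim: s => [|x s [h [t [<- okt]]]]; first by exists 0, [::].
have [Ei sz oks _ _] := btree_insertP x L0 (leqnn L) (leqnn L) okt (leq0n _).
move: (result _) Ei sz oks => ps Ei; rewrite /insert_at take0 drop0 in Ei.
case: ps Ei => [//|a [|b [|//]]] Ei _ oks.
  exists h, a.2; move: oks Ei; rewrite /= andbT => /andP[_ oka].
  by rewrite /slots_ints /= cats0.
by exists h.+1, [:: a; b]; rewrite btree_okS; rewrite andbF in oks; rewrite oks.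
Qed.

(** Read from the front, a leading 1 opens a gap of length 1, and a leading 0 lengthens the first
    gap or, if there is none, the trail. *)
Lemma gap_decode_surj B : exists s z,
  all (leq 1) s /\ B = gap_decode s ++ nseq z false.
Proof.
elim: B => [|c B [s [z [pos ->]]]]; first by exists [::], 0.
case: c; first by exists (1 :: s), z; rewrite gap_decode_cons.
case: s pos => [|g s] /=; first by exists [::], z.+1.
case/andP=> g0 pos; exists (g.+1 :: s), z; split=> //.
by rewrite !gap_decode_cons /= -{2}(prednK g0).
Qed.

Lemma gap_wf_exists B : exists S : gap_bv, gap_wf S /\ gap_bits S = B.
Proof.
have [s [z [pos ->]]] := gap_decode_surj B.
have [h [t [Et okt]]] := btree_exists s (leaf_cap_gt0 (size s)).
exists (GapBV t (counters_of s) z); rewrite /gap_wf /gap_bits /= Et.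
by rewrite btree_wf_ok.
Qed.

(** Here [isroot] is read as 0 or 1: only a leaf that is itself the root may be underfull. *)
Lemma light_ok lo hi l isroot h (t : btree h) :
  l <= lo -> btree_ok lo hi isroot t -> light l (leaves t) <= isroot.
Proof.
move=> le_l; elim: h isroot t => [|h IHh] isroot t.
  by case/andP=> _; rewrite /light /=; case: isroot => /=; lia.
rewrite btree_okS => /andP[_ oks]; apply: (@leq_trans 0) => //.
change (light l (slots_leaves t) <= 0).
elim: t oks => [//|e t IHt] /= /andP[/andP[_ oke] /IHt le_t].
by rewrite slots_leaves_cons light_cat; have := IHh _ _ oke; lia.
Qed.

(* The leaves with fewer than (leaf_cap m)/2 integers date from a time when at
   most m integers were stored, hence there are few of them. *)
Definition gap_inv (S : gap_bv) : Prop :=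
  gap_ok 1 S /\
  forall m, m <= cnt (totals S) -> light (leaf_cap m) (leaves (tree S)) <= m.+1.

Lemma gap_state_inv S : gap_state S -> gap_inv S.
Proof.
elim=> {S} [S /gap_wf_ok okS|S i c _ [okS inv] le_i|S i _ [okS inv] lt_i acc].
- split=> [|m le_m].
    case: okS => Et pos ok; split=> //.
    exact: btree_ok_mono (leaf_cap_gt0 _) (leqnn _) ok.
  case: okS => _ _ ok.
  exact: leq_trans (light_ok (leq_leaf_cap le_m) ok) _.
- have [_ okS' Ec Elv _] := gap_insertP c (ltnSn 0) (leaf_cap_gt0 _) okS le_i.
  split=> // m; rewrite Ec => le_m.
  have [le_m'|lt_m] := leqP m (cnt (totals S)).
    exact: leq_trans (Elv _ (leq_leaf_cap le_m)) (inv _ le_m').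
  case: okS' => Et' _ ok'.
  (* In this case m is the count reached by the insertion, so it is enough to bound the number of
     all leaves by the number of integers plus one. *)
  apply: leq_trans (count_size _ _) _.
  apply: leq_trans (size_leaves_root_leq (ltnSn 0) ok') _.
  have c1 : (c : nat) <= 1 by case: (c).
  by move: Ec; rewrite Et' /=; lia.
- have [_ okS' Ec Elv _] := gap_delete0P (ltnSn 0) okS lt_i acc.
  by split=> // m; rewrite Ec Elv; apply: inv.
Qed.

(** A leaf that is not light satisfies [l <= 2 * size], so its share [L] is at most [2 * K] times
    its load. *)
Lemma size_mul_light K l L s : L <= K * l ->
  size s * L <= light l s * L + 2 * K * size (flatten s).
Proof.
move=> leL; elim: s => [//|xs s IHs].
rewrite /light /= size_cat -/(light l s) !mulnDr mulSn mulnDl.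
case: ltnP => /= [lt_l|le_l]; first lia.
have : K * l <= K * (2 * size xs) by rewrite leq_mul2l le_l orbT.
by rewrite mulnCA mulnA; lia.
Qed.

(** With m = 2^(L/2), both m + 1 and L are at most 2m, so light leaves contribute at most 4m^2 <=
    4b. Since L <= 4 [leaf_cap m], the other leaves contribute at most 8b. *)
Lemma size_leaves_mul_leaf_cap S : gap_inv S -> 1 < cnt (totals S) ->
  size (leaves (tree S)) * leaf_cap (cnt (totals S)) <= 12 * cnt (totals S).
Proof.
case=> -[Et _ _] inv; set b := cnt _ in inv * => b1.
set L := trunc_log 2 b; pose k := L./2; pose m := 2 ^ k.
have leL : 2 ^ L <= b by apply: trunc_logP => //; lia.
have L0 : 0 < L by rewrite trunc_log_gt0.
have EL : leaf_cap b = L by rewrite /leaf_cap -/L; lia.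
have km : k < m by rewrite /m ltn_expl.
have Em : leaf_cap m = maxn 1 k by rewrite /leaf_cap /m trunc_expnK.
have mm : m * m <= b.
  by rewrite /m -expnD; apply: leq_trans leL; rewrite leq_exp2l // /k; lia.
have /inv light_m : m <= b by apply: leq_trans mm; rewrite leq_pmulr //; lia.
have leL4 : L <= 4 * leaf_cap m by rewrite Em /k; lia.
have := size_mul_light (leaves (tree S)) leL4.
rewrite -ints_flatten -[size (ints _)]/(cnt (counters_of _)) -Et -/b EL.
suff : light (leaf_cap m) (leaves (tree S)) * L <= 4 * b by lia.
apply: leq_trans (_ : (2 * m) * (2 * m) <= _); last by lia.
by apply: leq_mul; rewrite /k in km; lia.
Qed.

(** * Space *)

Local Open Scope classical_set_scope.
Local Open Scope ring_scope.

(** * Base-2 logarithms and the leaf capacity *)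

Lemma ln2_gt0 (R : realType) : 0 < ln (2 : R).
Proof. by apply: ln_gt0; rewrite ltr1n. Qed.

Lemma ler_log2 (R : realType) (x y : R) : 0 < x -> x <= y -> log2 x <= log2 y.
Proof.
move=> x0 le_xy; rewrite /log2 ler_pM2r ?invr_gt0 ?ln2_gt0 //.
by rewrite ler_ln // posrE // (lt_le_trans x0).
Qed.

Lemma log2_expn (R : realType) k : log2 ((2 ^ k)%:R : R) = k%:R.
Proof.
by rewrite /log2 natrX lnXn // -(mulr_natl (ln 2)) mulfK // gt_eqF // ln2_gt0.
Qed.

Lemma trunc_log_le_log2 (R : realType) m : (0 < m)%N ->
  (trunc_log 2 m)%:R <= log2 (m%:R : R).
Proof.
move=> m0; rewrite -[leLHS]log2_expn ler_log2 ?ltr0n ?expn_gt0 // ler_nat.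
exact: trunc_logP.
Qed.

Lemma log2_le_trunc_log (R : realType) m : (0 < m)%N ->
  log2 (m%:R : R) <= (trunc_log 2 m).+1%:R.
Proof.
move=> m0; rewrite -[leRHS]log2_expn ler_log2 ?ltr0n // ler_nat.
by rewrite ltnW // trunc_log_ltn.
Qed.

(** The capacity is at least 1 even when b < 2, hence the maximum with 2. *)
Lemma leaf_cap_le_log2 (R : realType) b :
  (leaf_cap b)%:R <= log2 ((maxn 2 b)%:R : R).
Proof.
apply: le_trans (trunc_log_le_log2 R _); last by rewrite leq_max.
rewrite ler_nat geq_max (leq_trunc_log 2 (leq_maxr 2 b)).
by rewrite (leq_trans _ (leq_trunc_log 2 (leq_maxl 2 b))).
Qed.

Lemma log2_le_leaf_cap (R : realType) b : (1 < b)%N ->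
  log2 (b%:R : R) <= (2 * leaf_cap b)%:R.
Proof.
move=> b1; apply: le_trans (log2_le_trunc_log R (ltnW b1)) _.
have := leaf_cap_gt0 b; rewrite ler_nat /leaf_cap; lia.
Qed.

(* The tangent line of log at A takes the place of Jensen's inequality: summed
   over the leaves, its linear part depends only on the sum of the integers. *)
Lemma packed_leaf_leq (R : realType) (L A : R) xs :
  0 < A -> (size xs)%:R <= L -> all (leq 1) xs ->
  (size xs * bitwidth (\max_(x <- xs) x))%:R <=
  (size xs)%:R * (log2 A + 1 - (ln 2)^-1) + L * (sumn xs)%:R * (A * ln 2)^-1.
Proof.
(* The empty leaf is set apart, since the tangent bound needs a positive maximum. *)
move=> A0 leL pos; case: (posnP (size xs)) => [/size0nil ->|xs0].
  by rewrite !mul0n !mul0r mulr0 mul0r addr0.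
set M := (\max_(x <- xs) x)%N.
have M0 : (0 < M)%N.
  rewrite /M; case: (xs) xs0 pos => [//|x s] _ /= /andP[x0 _].
  by rewrite big_cons leq_max x0.
have leM : (M <= sumn xs)%N.
  rewrite /M; elim: (xs) => [|x s IHs]; first by rewrite big_nil.
  by rewrite big_cons /=; lia.
have l2 := ln2_gt0 R.
(* This is ln(1 + x) <= x at x = M/A - 1. *)
have MA : log2 (M%:R : R) <= log2 A + (M%:R / A - 1) / ln 2.
  rewrite /log2 -mulrDl ler_pM2r ?invr_gt0 //.
  have M0r : 0 < (M%:R : R) by rewrite ltr0n.
  rewrite -lerBlDl -ln_div ?posrE //.
  have := @le_ln1Dx R (M%:R / A - 1); rewrite [1 + _]addrC subrK; apply.
  by rewrite ltrBrDl subrr divr_gt0.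
have bw : (bitwidth M)%:R <= log2 A + 1 - (ln 2)^-1 + M%:R * (A * ln 2)^-1.
  rewrite /bitwidth -natr1; have := trunc_log_le_log2 R M0.
  have -> : M%:R * (A * ln 2)^-1 = M%:R / A / ln 2 by rewrite invfM mulrA.
  move: MA; rewrite mulrBl mul1r; lra.
rewrite natrM; apply: le_trans (ler_wpM2l (ler0n _ _) bw) _.
(* The linear term is coarsened by size <= L and M <= sum, which makes it summable over the
   leaves. *)
rewrite mulrDr lerD2l mulrA ler_wpM2r //.
  by rewrite invr_ge0 mulr_ge0 // ltW.
by rewrite ler_pM // ?ler_nat.
Qed.

Lemma packed_leaves_leq (R : realType) (L A : R) (ls : seq (seq nat)) :
  0 < A -> (forall xs, xs \in ls -> (size xs)%:R <= L) ->
  all (all (leq 1)) ls ->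
  (sumn [seq (size xs * bitwidth (\max_(x <- xs) x))%N | xs <- ls])%:R <=
  (size (flatten ls))%:R * (log2 A + 1 - (ln 2)^-1)
    + L * (sumn (flatten ls))%:R * (A * ln 2)^-1.
Proof.
move=> A0; elim: ls => [|xs ls IHls] leL.
  by rewrite /= !mul0r mulr0 mul0r addr0.
move=> /= /andP[pos /IHls IH].
have := packed_leaf_leq A0 (leL _ (mem_head _ _)) pos.
have := IH (fun x xin => leL x (mem_behead (s := xs :: ls) xin)).
rewrite size_cat sumn_cat !natrD mulrDr !mulrDl; lra.
Qed.

Lemma sumn_leaf_bits w ls :
  sumn [seq leaf_bits w xs | xs <- ls] =
  (2 * w * size ls +
   sumn [seq size xs * bitwidth (\max_(x <- xs) x) | xs <- ls])%N.
Proof. by elim: ls => [|xs ls IHls] /=; rewrite ?IHls /leaf_bits; lia. Qed.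

(** Counters and pointers take at most 55 words per leaf and there are at most 24 b / log b leaves,
    whence 1320 = 55 * 24. The other 1 in the constant pays for the one extra bit of each packed
    integer. *)
Lemma gap_space_leq (R : realType) (kappa : R) S n b w :
  gap_inv S -> size (gap_bits S) = n -> count_mem true (gap_bits S) = b ->
  (1 < b)%N -> w%:R <= kappa * log2 (n%:R : R) ->
  (gap_space w S)%:R <=
    b%:R * (log2 (n%:R / b%:R) + log2 (log2 b%:R)
            + (1 + 1320 * `|kappa|) * (log2 n%:R / log2 b%:R)) :> R.
Proof.
move=> invS; have [okS _] := invS.
rewrite (size_gap_bits okS) (count_gap_bits okS) => En Eb b1 le_w.
have [Et pos ok] := okS.
have Es : size (ints (tree S)) = b by rewrite -Eb Et.
have le_sum : (sumn (ints (tree S)) <= n)%N by rewrite -En Et leq_addr.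
have le_bn : (b <= n)%N.
  by apply: leq_trans le_sum; rewrite -Es size_leq_sumn.
have b0 : 0 < (b%:R : R) by rewrite ltr0n; lia.
have n0 : 0 < (n%:R : R) by rewrite ltr0n; lia.
set N := size (leaves (tree S)).
have := size_leaves_mul_leaf_cap invS; rewrite Eb => /(_ b1) le_N.
have lb1 : 1 <= log2 (b%:R : R).
  by rewrite -[leLHS](log2_expn R 1) ler_log2 // ler_nat.
have lnb : log2 (b%:R : R) <= log2 n%:R by rewrite ler_log2 // ler_nat.
set lb := log2 (b%:R : R) in lb1 lnb *; set ln_ := log2 (n%:R : R) in le_w lnb *.
have lb0 : 0 < lb by apply: lt_le_trans lb1.
(* The 12 of the leaf count is doubled by log b <= 2 [leaf_cap b]. *)
have Nlb : N%:R * lb <= 24 * b%:R.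
  apply: le_trans (ler_wpM2l (ler0n _ _) (log2_le_leaf_cap R b1)) _.
  by rewrite -!natrM ler_nat; lia.
(* At this tangent point the linear term is at most b / ln 2, which cancels the [- (ln 2)^-1]
   charged for each of the b integers. *)
pose A : R := n%:R / b%:R * lb.
have A0 : 0 < A by rewrite mulr_gt0 // divr_gt0.
have EA : log2 A = log2 (n%:R / b%:R) + log2 lb.
  by rewrite /log2 -mulrDl -lnM // posrE divr_gt0.
have leL xs : xs \in leaves (tree S) -> (size xs)%:R <= lb.
  move=> xs_in; have /allP/(_ _ xs_in) /= := leaves_size_leq ok.
  rewrite Eb -(ler_nat R) => /le_trans; apply.
  by apply: le_trans (leaf_cap_le_log2 R b) _; rewrite (maxn_idPr b1).
have := packed_leaves_leq A0 leL; rewrite -leaves_all_ints => /(_ pos).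
rewrite -ints_flatten Es; set P := sumn _.
have l2 := ln2_gt0 R.
have le_lin : lb * (sumn (ints (tree S)))%:R / (A * ln 2) <= b%:R / ln 2.
  rewrite ler_pdivrMr ?(mulr_gt0 A0 l2) //.
  have -> : b%:R / ln 2 * (A * ln 2) = lb * n%:R.
    by rewrite /A; field; rewrite !gt_eqF.
  by rewrite ler_wpM2l ?ler_nat // ltW.
move=> le_P.
have {le_P le_lin} le_P : P%:R <= b%:R * (log2 A + 1).
  apply: le_trans le_P _; apply: le_trans (lerD (lexx _) le_lin) _.
  by rewrite -mulrDr subrK.
(* The 55 words are 48 per internal node, of which there are fewer than leaves, 2 per leaf, and 5
   for the top-level record, charged to the leaves as well. *)
have le_space : (gap_space w S <= 55 * (N * w) + P)%N.
  rewrite /gap_space btree_bitsE sumn_leaf_bits -/P -/N.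
  have : (inner_nodes (tree S) < N)%N by apply: inner_nodes_lt ok.
  by rewrite /fanout; nia.
have le_Nw : (N * w)%:R <= 24 * b%:R * (`|kappa| * (ln_ / lb)) :> R.
  rewrite natrM.
  have ln0 : 0 <= ln_ by apply: le_trans lnb; apply: ltW.
  have le_w' : w%:R <= `|kappa| * ln_.
    by apply: le_trans le_w _; rewrite ler_wpM2r // ler_norm.
  apply: le_trans (ler_wpM2l (ler0n _ _) le_w') _.
  have -> : N%:R * (`|kappa| * ln_) = N%:R * lb * (`|kappa| * (ln_ / lb)).
    by field; rewrite gt_eqF.
  by rewrite ler_wpM2r // mulr_ge0 // divr_ge0 // ltW.
(* The extra bit per integer is absorbed by log n / log b, which is at least 1. *)
have ratio : b%:R <= b%:R * (ln_ / lb).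
  by rewrite ler_peMr ?ler0n // ler_pdivlMr // mul1r.
move: le_space; rewrite -(ler_nat R) natrD natrM -EA => /le_trans; apply.
have -> : b%:R * (log2 A + (1 + 1320 * `|kappa|) * (ln_ / lb)) =
  b%:R * log2 A + b%:R * (ln_ / lb) + 55 * (24 * b%:R * (`|kappa| * (ln_ / lb))).
  by ring.
move: le_P; rewrite mulrDr mulr1; lra.
Qed.

Theorem theorem2 (R : realType) (kappa : R) :
  (forall B : seq bool, exists S : gap_bv, gap_wf S /\ gap_bits S = B) /\
  (exists (C : R) (eps : nat -> R),
     eps n @[n --> \oo] --> (0 : R) /\
     forall (B : seq bool) (S : gap_bv) (n b w : nat),
       gap_state S -> gap_bits S = B -> size B = n -> count_mem true B = b ->
       (1 < b)%N -> w%:R <= kappa * log2 (n%:R : R) ->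
       (gap_space w S)%:R <=
         2 * b%:R *
           (log2 (n%:R / b%:R) + log2 (log2 b%:R)
              + C * (log2 n%:R / log2 b%:R)) * (1 + eps n)) /\
  (exists C : R,
     forall (B : seq bool) (S : gap_bv) (n b : nat),
       gap_state S -> gap_bits S = B -> size B = n -> count_mem true B = b ->
       let fast (t : nat) := t%:R <= C * log2 ((maxn 2 b)%:R : R) in
       [/\ (forall i : nat, (i < n)%N ->
              result (gap_access S i) = bv_access B i /\
              fast (time (gap_access S i))),
           (forall (c : bool) (i : nat), (i <= n)%N ->
              result (gap_rank c S i) = bv_rank c B i /\
              fast (time (gap_rank c S i))),
           (forall (c : bool) (j : nat), (0 < j <= count_mem c B)%N ->
              result (gap_select c S j) = bv_select c B j /\
              fast (time (gap_select c S j))),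
           (forall (c : bool) (i : nat), (i <= n)%N ->
              let S' := result (gap_insert i c S) in
              [/\ gap_bits S' = bv_insert i c B,
                  fast (time (gap_insert i c S))
                & gap_wf S -> leaf_cap (b + c) = leaf_cap b -> gap_wf S'])
         & (forall i : nat, (i < n)%N -> bv_access B i = false ->
              let S' := result (gap_delete0 i S) in
              [/\ gap_bits S' = bv_delete i B,
                  fast (time (gap_delete0 i S))
                & gap_wf S -> gap_wf S'])]).
Proof.
split; first exact: gap_wf_exists.
split.
  (* The bound of [gap_space_leq] has leading factor 1, so the error term can be 0, and passing to
     factor 2 only takes the nonnegativity of the bracket [X]. *)
  exists (1 + 1320 * `|kappa|), (fun=> 0); split; first exact: cvg_cst.
  move=> B S n b w /gap_state_inv invS EB En Eb b1 le_w; subst B.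
  apply: le_trans (gap_space_leq invS En Eb b1 le_w) _.
  have le_bn : (b <= n)%N by rewrite -En -Eb count_size.
  have b0 : 0 < (b%:R : R) by rewrite ltr0n; lia.
  have lb1 : 1 <= log2 (b%:R : R).
    by rewrite -[leLHS](log2_expn R 1) ler_log2 // ler_nat.
  have log2_ge0 (x : R) : 1 <= x -> 0 <= log2 x.
    by move=> x1; rewrite -[leLHS](log2_expn R 0) ler_log2.
  have C0 : 0 <= 1 + 1320 * `|kappa| :> R.
    by rewrite addr_ge0 ?ler01 ?mulr_ge0 ?ler0n ?normr_ge0.
  move: (1 + _) C0 => C C0; set X := _ + C * _.
  have X0 : 0 <= X.
    apply: addr_ge0; first apply: addr_ge0.
    - by apply: log2_ge0; rewrite ler_pdivlMr // mul1r ler_nat.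
    - exact: log2_ge0.
    - by rewrite mulr_ge0 // divr_ge0 // log2_ge0 // ler1n; lia.
  by rewrite addr0 mulr1 -mulrA ler_peMl ?ler1n // mulr_ge0 // ltW.
exists 100 => B S n b /gap_state_inv [okS _] EB En Eb fast; subst B.
have Ec : cnt (totals S) = b by rewrite -Eb (count_gap_bits okS).
have fastP t : (t <= 100 * leaf_cap (cnt (totals S)))%N -> fast t.
  rewrite -(ler_nat R) => /le_trans; apply.
  by rewrite natrM ler_wpM2l // Ec leaf_cap_le_log2.
split.
- move=> i; rewrite -En => lt_i.
  by have [Er tm] := gap_accessP (ltn0Sn 0) okS lt_i; split=> //; apply: fastP.
- move=> c i; rewrite -En => le_i.
  by have [Er tm] := gap_rankP (ltn0Sn 0) okS c le_i; split=> //; apply: fastP.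
- move=> c j le_j.
  by have [Er tm] := gap_selectP (ltn0Sn 0) okS le_j; split=> //; apply: fastP.
- move=> c i; rewrite -En => le_i S'.
  have [Er _ _ _ tm] := gap_insertP c (ltn0Sn 0) (leaf_cap_gt0 _) okS le_i.
  split=> //; first exact: fastP.
  (* A second application, now with [lo] equal to the capacity, tracks the prescribed loads; as the
     capacity is the same afterwards, the outcome is again well-formed. *)
  move=> /gap_wf_ok wfS cap; apply/gap_wf_ok.
  have [_ wfS' Ec' _ _] := gap_insertP c (leaf_cap_gt0 _) (leqnn _) wfS le_i.
  by rewrite Ec' Ec cap -Ec.
- move=> i; rewrite -En => lt_i acc S'.
  have [Er _ _ _ tm] := gap_delete0P (ltn0Sn 0) okS lt_i acc.
  split=> //; first exact: fastP.
  move=> /gap_wf_ok wfS; apply/gap_wf_ok.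
  have [_ wfS' Ec' _ _] := gap_delete0P (leaf_cap_gt0 _) wfS lt_i acc.
  by rewrite Ec'.
Qed.
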